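(* Let $K$ be a field, $S=K[x_1,\dots,x_n]$, and let $I\subset S$ be an ideal belonging to one of the following families of polymatroidal ideals: (a) polymatroidal ideals generated in degree $2$ which are not squarefree; (b) transversal polymatroidal ideals; (c) principal Borel ideals. Then $I^{(k)}=I^k$ for all $k\ge1$. In particular, $\mathrm{reg}\,I^{(k)}=\mathrm{reg}\,I^k$ and $I^{(k)}$ has linear quotients, and so it is componentwise linear, for all $k\ge1$.
   Context: $S$ is standard graded; $\mathrm{reg}$ is Castelnuovo–Mumford regularity. The $k$th symbolic power is $I^{(k)}=\bigcap_{P\in\mathrm{Ass}(I)}(I^kS_P\cap S)$, with $\mathrm{Ass}(I)=\mathrm{Ass}(S/I)$. Let $\mathcal{G}(I)$ be the minimal monomial generating set of a monomial ideal $I$ and $\deg_{x_i}(u)$ the exponent of $x_i$ in a monomial $u$. A nonzero monomial ideal $I$ is *polymatroidal* if it is generated in a single degree and for all $u,v\in\mathcal{G}(I)$ and every $i$ with $\deg_{x_i}(u)>\deg_{x_i}(v)$ there is $j$ with $\deg_{x_j}(u)<\deg_{x_j}(v)$ and $x_j(u/x_i)\in\mathcal{G}(I)$. ''Not squarefree'' means that some minimal generator is not squarefree. A *transversal* polymatroidal ideal is a product of finitely many (not necessarily distinct) monomial prime ideals $(x_i:i\in F)$, $\emptyset\ne F\subseteq\{1,\dots,n\}$. For a monomial $u=x_{i_1}\cdots x_{i_d}$ with $i_1\le\dots\le i_d$, the *principal Borel ideal* $B(u)$ is the monomial ideal with $\mathcal{G}(B(u))=\{x_{j_1}\cdots x_{j_d}: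 j_1\le i_1,\dots,j_d\le i_d\}$. A monomial ideal $L$ has linear quotients if its minimal monomial generators can be ordered $u_1,\dots,u_s$ so that $(u_1,\dots,u_{i-1}):(u_i)$ is generated by variables for $i=2,\dots,s$. A graded ideal $L$ is componentwise linear if for each $j$ the ideal generated by all homogeneous elements of $L$ of degree $j$ has a linear resolution. *)

(* Defs.v *)
From HB Require Import structures.
From mathcomp Require Import all_boot all_order all_algebra.
From mathcomp Require Import fraction.
From mathcomp Require Import boolp classical_sets.
From mathcomp Require Import mpoly.

Set Implicit Arguments.
Unset Strict Implicit.
Unset Printing Implicit Defensive.

Import Order.TTheory GRing.Theory Num.Theory.
Local Open Scope classical_set_scope.
Local Open Scope ring_scope.

(* [A] is meant to be a subring of [R]; [A = setT] gives the ideals of [R]. *)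
Definition is_ideal_of (R : comNzRingType) (A I : set R) : Prop :=
  [/\ I `<=` A, I 0, forall x y, I x -> I y -> I (x + y)
    & forall a x, A a -> I x -> I (a * x)].

Definition ideal_gen_in (R : comNzRingType) (A X : set R) : set R :=
  smallest (is_ideal_of A) X.

Definition is_ideal (R : comNzRingType) (I : set R) : Prop :=
  is_ideal_of setT I.

Definition ideal_gen (R : comNzRingType) (X : set R) : set R :=
  ideal_gen_in setT X.

Definition ideal_mul (R : comNzRingType) (I J : set R) : set R :=
  ideal_gen [set a * b | a in I & b in J].

Definition ideal_pow (R : comNzRingType) (I : set R) (k : nat) : set R :=
  iter k (ideal_mul I) setT.

Definition colon (R : comNzRingType) (I J : set R) : set R :=
  [set a | forall b, J b -> I (a * b)].

Definition prime_ideal (R : comNzRingType) (P : set R) : Prop :=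
  [/\ is_ideal P, ~ P 1 & forall a b, P (a * b) -> P a \/ P b].

(* Ass(R/I): the primes that are annihilators of an element f + I of R/I. *)
Definition Ass (R : comNzRingType) (I : set R) : set (set R) :=
  [set P | prime_ideal P /\ exists f, P = [set a | I (a * f)]].

(* R_P as a subring of Frac(R) *)
Definition localization (R : idomainType) (P : set R) : set {fraction R} :=
  [set tofrac a / tofrac s | a in setT & s in ~` P].

(* J R_P, and J R_P \cap R *)
Definition loc_ideal (R : idomainType) (P J : set R) : set {fraction R} :=
  ideal_gen_in (localization P) (@tofrac R @` J).

Definition loc_contraction (R : idomainType) (P J : set R) : set R :=
  [set a | loc_ideal P J (tofrac a)].

(* If I = R then Ass I is empty and the intersection is R. *)
Definition symbolic_power (R : idomainType) (I : set R) (k : nat) : set R :=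
  \bigcap_(P in Ass I) loc_contraction P (ideal_pow I k).

Definition monomial_ideal (n : nat) (K : fieldType) (I : set {mpoly K[n]}) :
    Prop :=
  exists A : set 'X_{1..n}, I = ideal_gen [set 'X_[K, m] | m in A].

(* Exponents of the monomials of I that are minimal for divisibility. *)
Definition mingens (n : nat) (K : fieldType) (I : set {mpoly K[n]}) :
    set 'X_{1..n} :=
  [set m | I 'X_[m] /\ forall m', I 'X_[m'] -> (m' <= m)%MM -> m' = m].

Definition generated_in_degree (n : nat) (K : fieldType)
    (I : set {mpoly K[n]}) (d : nat) : Prop :=
  forall u, mingens I u -> mdeg u = d.

Definition polymatroidal (n : nat) (K : fieldType) (I : set {mpoly K[n]}) :
    Prop :=
  [/\ monomial_ideal I, exists2 f, I f & f != 0,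
      exists d, generated_in_degree I d
    & forall u v, mingens I u -> mingens I v ->
      forall i, (v i < u i)%N ->
      exists2 j, (u j < v j)%N & mingens I (u - U_(i) + U_(j))%MM].

Definition squarefree_mnm (n : nat) (m : 'X_{1..n}) : Prop :=
  forall i, (m i <= 1)%N.

Definition polymatroidal_deg2_not_squarefree (n : nat) (K : fieldType)
    (I : set {mpoly K[n]}) : Prop :=
  [/\ polymatroidal I, generated_in_degree I 2
    & exists2 u, mingens I u & ~ squarefree_mnm u].

(* (x_i : i in F); this is the zero ideal when F is empty. *)
Definition var_ideal (n : nat) (K : fieldType) (F : {set 'I_n}) :
    set {mpoly K[n]} :=
  ideal_gen [set 'X_i | i in [set` F]].

Definition transversal_polymatroidal (n : nat) (K : fieldType)
    (I : set {mpoly K[n]}) : Prop :=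
  exists2 s : seq {set 'I_n},
    forall F, F \in s -> exists i, i \in F
    & I = \big[@ideal_mul _ / setT]_(F <- s) var_ideal F.

Definition mnm_of_word (n : nat) (w : seq 'I_n) : 'X_{1..n} :=
  (\big[@mnm_add n / 0]_(i <- w) U_(i))%MM.

(* I = B(u), where the sorted word w lists the indices i_1 <= ... <= i_d of u;
   [all2] also requires the two words to have the same length. *)
Definition principal_borel (n : nat) (K : fieldType) (I : set {mpoly K[n]}) :
    Prop :=
  exists w : seq 'I_n,
    [/\ sorted (fun i j : 'I_n => (i <= j)%N) w, monomial_ideal I
      & mingens I = [set mnm_of_word v |
          v in [set v | all2 (fun j i : 'I_n => (j <= i)%N) v w]]].

Definition linear_quotients (n : nat) (K : fieldType) (I : set {mpoly K[n]}) :
    Prop :=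
  monomial_ideal I /\
  exists s : seq 'X_{1..n},
    [/\ uniq s, mingens I = [set` s]
      & forall i, (0 < i < size s)%N ->
        exists F : {set 'I_n},
          colon (ideal_gen [set 'X_[K, m] | m in [set` take i s]])
                (ideal_gen [set 'X_[K, nth 0%MM s i]]) = var_ideal F].

Definition graded_ideal (n : nat) (K : fieldType) (I : set {mpoly K[n]}) :
    Prop :=
  is_ideal I /\ forall f, I f -> forall d, I (pihomog mdeg d f).

(* Data of a graded complex
     ... -> F_2 -> F_1 -> F_0 -> S,   F_i = \bigoplus_p S(- shift i p),
   of free modules of rank [rk i]. Elements of F_i are row vectors, and the
   maps F_0 -> S and F_{i+1} -> F_i are right multiplication by [aug] and
   [diff i]. *)
Record free_complex (n : nat) (K : fieldType) := FreeComplex {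
  rk : nat -> nat;
  shift : forall i, 'I_(rk i) -> nat;
  aug : 'cV[{mpoly K[n]}]_(rk 0);
  diff : forall i, 'M[{mpoly K[n]}]_(rk i.+1, rk i) }.

(* The maps are homogeneous of degree 0. *)
Definition graded_complex (n : nat) (K : fieldType) (C : free_complex n K) :
    Prop :=
  (forall p, aug C p 0 \is (shift p).-homog) /\
  (forall i p q, diff C i p q = 0 \/
     exists2 e, shift p = (shift q + e)%N & diff C i p q \is e.-homog).

Definition resolves (n : nat) (K : fieldType) (C : free_complex n K)
    (I : set {mpoly K[n]}) : Prop :=
  [/\ range (fun v : 'rV_(rk C 0) => (v *m aug C) 0 0) = I,
      range (fun w : 'rV_(rk C 1) => w *m diff C 0) =
        [set v | v *m aug C = 0]
    & forall i, range (fun w : 'rV_(rk C i.+2) => w *m diff C i.+1) =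
        [set v | v *m diff C i = 0]].

(* The image of F_{i+1} lies in (x_1, ..., x_n) F_i. *)
Definition minimal_complex (n : nat) (K : fieldType) (C : free_complex n K) :
    Prop :=
  forall i p q, (diff C i p q)@_0%MM = 0.

Definition minimal_graded_resolution (n : nat) (K : fieldType)
    (I : set {mpoly K[n]}) (C : free_complex n K) : Prop :=
  [/\ graded_complex C, resolves C I & minimal_complex C].

(* reg I = max {j - i : beta_{i,j}(I) <> 0}, read off from a minimal graded
   free resolution of the ideal I (not of S/I), which is unique up to
   isomorphism. The maximum exists for every nonzero graded ideal; [reg] is 0
   by default where it does not. *)
Definition is_reg (n : nat) (K : fieldType) (I : set {mpoly K[n]}) (r : int) :
    Prop :=
  exists C : free_complex n K,
    [/\ minimal_graded_resolution I C,
        exists i (p : 'I_(rk C i)), r = (shift p)%:Z - i%:Z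
      & forall i (p : 'I_(rk C i)), (shift p)%:Z - i%:Z <= r].

Definition reg (n : nat) (K : fieldType) (I : set {mpoly K[n]}) : int :=
  xget 0 [set r | is_reg I r].

(* The zero ideal has a linear resolution, by a complex of rank 0. *)
Definition linear_resolution (n : nat) (K : fieldType)
    (I : set {mpoly K[n]}) : Prop :=
  exists d (C : free_complex n K),
    minimal_graded_resolution I C /\
    forall i (p : 'I_(rk C i)), shift p = (d + i)%N.

Definition degree_component_ideal (n : nat) (K : fieldType)
    (I : set {mpoly K[n]}) (j : nat) : set {mpoly K[n]} :=
  ideal_gen [set f | I f /\ f \is j.-homog].

Definition componentwise_linear (n : nat) (K : fieldType)
    (I : set {mpoly K[n]}) : Prop :=
  graded_ideal I /\ forall j, linear_resolution (degree_component_ideal I j).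

(* Main.v *)
Require Import Defs.
From HB Require Import structures.
From mathcomp Require Import all_boot all_order all_algebra.
From mathcomp Require Import fraction.
From mathcomp Require Import boolp classical_sets.
From mathcomp Require Import mpoly.
From mathcomp Require Import zify ring.

(** Everything is reduced to sets of exponents. For a set [A] of exponents let
    [mideal A] be the ideal generated by the monomials with exponents in [A];
    then powers of ideals are iterated Minkowski sums of exponent sets.

    Symbolic powers. For a set [F] of variables, the polynomials all of whose
    monomials have degree at least [c] in the variables of [F] form an ideal
    that is primary to [var_ideal F] ([ford_cancel]). Hence the equality of the
    symbolic and the ordinary [k]-th power follows when the ordinary power is an
    intersection of such ideals, for sets [F] such that [var_ideal F] is
    associated to the ideal ([symbolic_power_mideal]). For a transversal ideal
    the inequalities that describe the powers are those of Hall's theorem, and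
    it suffices to consider unions [F] of connected subfamilies of the given
    sets ([transversal_base_hall]). For such [F], a spanning tree of the
    subfamily gives a monomial whose annihilator modulo the ideal is
    [var_ideal F] ([linked_saturated]). A principal Borel ideal [B(u)] is transversal, being
    the product of the ideals [(x_1, ..., x_i)] over the letters [x_i] of [u].
    A polymatroidal ideal of degree 2 is the edge ideal of a graph with loops;
    if there is a loop, then non-adjacency is an equivalence relation on the
    vertices without a loop. The powers are then described by the degree in all
    vertices and by the degrees in the neighbourhoods of the vertices
    ([covered_mpow2]); if [F] is the neighbourhood of [c], then [var_ideal F]
    is [I : x_c], and the neighbourhood of a vertex with a loop contains
    all vertices.

    Linear quotients. In all cases the exponents of the generators of a power
    satisfy the exchange property ([transversal_base_exchange],
    [exchange_mpow2]). Listing them in increasing lexicographic order gives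
    colon ideals that are generated by variables ([colon_exchange]).

    Componentwise linearity. Exchange is preserved by multiplication with the
    maximal ideal, so that each component of the power is again generated by a
    set with exchange ([exchange_component]). Linear quotients by ideals of
    variables give a linear resolution, built as an iterated mapping cone
    ([linres_cone]); the Koszul complexes that enter the construction are
    themselves iterated cones ([linres_var_ideal]). *)

Set Implicit Arguments.
Unset Strict Implicit.
Unset Printing Implicit Defensive.

Import Order.TTheory GRing.Theory.

Local Open Scope classical_set_scope.
Local Open Scope ring_scope.

(** * Monomial ideals *)

Lemma ideal_gen_is_ideal (R : comNzRingType) (X : set R) :
  is_ideal (ideal_gen X).
Proof.
split=> // [|x y Ix Iy|a x _ Ix] J [JI XJ]; have [_ J0 JD JM] := JI.
- exact: J0.
- by apply: JD; [apply: Ix | apply: Iy].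
- by apply: JM => //; apply: Ix.
Qed.

Lemma ideal_gen_sub (R : comNzRingType) (X J : set R) :
  is_ideal J -> X `<=` J -> ideal_gen X `<=` J.
Proof. exact: smallest_sub. Qed.

Lemma ideal_sum (R : comNzRingType) (J : set R) (T : eqType) (r : seq T)
    (F : T -> R) :
  is_ideal J -> (forall x, x \in r -> J (F x)) -> J (\sum_(x <- r) F x).
Proof.
move=> [_ J0 JD _] JF; rewrite big_seq.
by apply: (big_ind J) => // x; apply: JF.
Qed.

Lemma mem_colon_principal (R : comNzRingType) (J : set R) (u f : R) :
  is_ideal J -> colon J (ideal_gen [set u]) f <-> J (f * u).
Proof.
move=> [_ J0 JD JM]; split=> [fJ|fu b].
  by apply: fJ; apply: sub_gen_smallest.
suff : ideal_gen [set u] `<=` [set b | J (f * b)] by apply.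
apply: ideal_gen_sub; last by move=> _ -> /=.
split=> //= [|x y Jx Jy|a x _ Jx].
- by rewrite mulr0.
- by rewrite mulrDr; apply: JD.
- by rewrite mulrCA; apply: JM.
Qed.

Section MonomialIdeals.
Context {n : nat}.
Implicit Types (A B : set 'X_{1..n}) (m u v : 'X_{1..n}) (i j l : 'I_n).

Definition covered A u := exists2 a, A a & (a <= u)%MM.

Definition msum A B : set 'X_{1..n} := [set (a + b)%MM | a in A & b in B].

Definition mpow A k : set 'X_{1..n} := iter k (msum A) [set 0%MM].

Lemma covered_le A u v : (u <= v)%MM -> covered A u -> covered A v.
Proof. by move=> uv [a Aa au]; exists a => //; apply: lepm_trans uv. Qed.

Lemma covered_id A u : A u -> covered A u.
Proof. by move=> Au; exists u => //; apply: lepm_refl. Qed.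

Lemma lem_add2 m1 m2 u1 u2 :
  (m1 <= u1)%MM -> (m2 <= u2)%MM -> (m1 + m2 <= u1 + u2)%MM.
Proof.
by move=> /mnm_lepP h1 /mnm_lepP h2; apply/mnm_lepP => i; rewrite !mnmDE leq_add.
Qed.

Lemma covered_msum A B u v :
  covered A u -> covered B v -> covered (msum A B) (u + v)%MM.
Proof.
move=> [a Aa au] [b Bb bv]; exists (a + b)%MM; first by exists a => //; exists b.
exact: lem_add2.
Qed.

Lemma lem_mdeg_eq a u : (a <= u)%MM -> mdeg a = mdeg u -> a = u.
Proof.
move=> /submK au e; have := mdegD (u - a) a; rewrite au e => /eqP.
by rewrite -[X in X == _]add0n eqn_add2r eq_sym mdeg_eq0 -{2}au => /eqP->; rewrite add0m.
Qed.

Lemma covered_eq A d u :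
  (forall a, A a -> mdeg a = d) -> mdeg u = d -> covered A u -> A u.
Proof. by move=> Ad ud [a Aa au]; rewrite -(lem_mdeg_eq au) // Ad. Qed.

Lemma msum_mdeg A B d e :
  (forall a, A a -> mdeg a = d) -> (forall a, B a -> mdeg a = e) ->
  forall a, msum A B a -> mdeg a = (d + e)%N.
Proof.
by move=> Ad Be _ [a Aa [b Bb <-]]; rewrite mdegD (Ad _ Aa) (Be _ Bb).
Qed.

Lemma mpow_mdeg A d k :
  (forall a, A a -> mdeg a = d) -> forall a, mpow A k a -> mdeg a = (k * d)%N.
Proof.
move=> Ad; elim: k => [|k IH] a /=; first by move=> ->; rewrite mdeg0.
by rewrite mulSn; apply: msum_mdeg.
Qed.

Context {K : fieldType}.
Implicit Types (f g : {mpoly K[n]}) (I : set {mpoly K[n]}).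

Definition mideal A : set {mpoly K[n]} := ideal_gen [set 'X_[K, m] | m in A].

Definition supported (Q : set 'X_{1..n}) : set {mpoly K[n]} :=
  [set f | forall m, m \in msupp f -> Q m].

Lemma supported_ideal (Q : set 'X_{1..n}) :
  (forall u v, (u <= v)%MM -> Q u -> Q v) -> is_ideal (supported Q).
Proof.
move=> Qle; split=> // [m|f g Qf Qg m|f g _ Qg m].
- by rewrite msupp0.
- by move/msuppD_le; rewrite mem_cat => /orP[/Qf|/Qg].
- move=> /msuppM_le /allpairsP [[m1 m2] /= [_ m2g ->]].
  exact/Qle/(Qg _ m2g)/lem_addl.
Qed.

Lemma supported_mideal (Q : set 'X_{1..n}) A :
  (forall u v, (u <= v)%MM -> Q u -> Q v) -> A `<=` Q ->
  mideal A `<=` supported Q.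
Proof.
move=> Qle AQ; apply: ideal_gen_sub; first exact: supported_ideal.
by move=> _ [a Aa <-] m; rewrite msuppX inE => /eqP->; apply: AQ.
Qed.

Lemma mideal_is_ideal A : is_ideal (mideal A).
Proof. exact: ideal_gen_is_ideal. Qed.

Lemma mem_mideal A m : A m -> mideal A 'X_[m].
Proof. by move=> Am; apply: sub_gen_smallest; exists m. Qed.

Lemma midealE A : mideal A = supported (covered A).
Proof.
apply/seteqP; split.
  by apply: supported_mideal => [u v|u]; [apply: covered_le | apply: covered_id].
move=> f fA; rewrite [f]mpolyE; have MI := mideal_is_ideal A.
apply: ideal_sum => // m /fA [a Aa am].
have [_ _ _ IM] := MI.
rewrite -mul_mpolyC -(submK am) mpolyXD mulrA; apply: IM => //.
exact: mem_mideal.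
Qed.

Lemma midealX A m : mideal A 'X_[m] <-> covered A m.
Proof.
rewrite midealE; split=> [/(_ m)|cm m']; first by rewrite msuppX inE eqxx; apply.
by rewrite msuppX inE => /eqP->.
Qed.

Lemma mideal_mul A B : ideal_mul (mideal A) (mideal B) = mideal (msum A B).
Proof.
apply/seteqP; split; apply: ideal_gen_sub; try exact: ideal_gen_is_ideal.
  move=> _ [f fA [g gB <-]]; rewrite midealE => m; move: fA gB; rewrite !midealE => fA gB.
  move=> /msuppM_le /allpairsP [[m1 m2] /= [m1f m2g ->]].
  by apply: covered_msum; [apply: fA | apply: gB].
move=> _ [_ [a Aa [b Bb <-]] <-]; apply: sub_gen_smallest.
exists 'X_[a]; first exact: mem_mideal.
by exists 'X_[b]; [exact: mem_mideal | rewrite mpolyXD].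
Qed.

Lemma mideal1 : mideal [set 0%MM] = setT.
Proof.
apply/seteqP; split=> // f _; rewrite midealE => m _; exists 0%MM => //.
by apply/mnm_lepP => i; rewrite mnm0E.
Qed.

Lemma mideal_pow A k : ideal_pow (mideal A) k = mideal (mpow A k).
Proof.
elim: k => [|k IH] /=; first by rewrite mideal1.
by rewrite -mideal_mul -IH.
Qed.

Lemma var_idealE (F : {set 'I_n}) :
  var_ideal F = mideal [set U_(i)%MM | i in [set` F]].
Proof. by congr ideal_gen; rewrite image_comp. Qed.

Lemma mingens_mideal A d :
  (forall a, A a -> mdeg a = d) -> mingens (mideal A) = A.
Proof.
move=> Ad; apply/seteqP; split=> m.
  move=> [/midealX [a Aa am] mmin].
  by rewrite -(mmin a) //; apply: mem_mideal.
move=> Am; split; first exact: mem_mideal.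
move=> m' /midealX [a Aa am'] m'm; apply/esym.
have e : a = m by apply: lem_mdeg_eq; [apply: lepm_trans m'm | rewrite !Ad].
move: am' m'm; rewrite e => /mnm_lepP mm' /mnm_lepP m'm.
by apply/mnmP => i; apply/eqP; rewrite eqn_leq mm' m'm.
Qed.

(** Divisibility of monomials is well founded, so that every monomial of the ideal
    lies above a minimal one. *)
Lemma monomial_ideal_mingens I : monomial_ideal I -> I = mideal (mingens I).
Proof.
move=> [A IA]; have II : is_ideal I by rewrite IA; apply: ideal_gen_is_ideal.
have key d m : (mdeg m < d)%N -> I 'X_[m] -> covered (mingens I) m.
  elim: d m => // d IH m md Im.
  have [mm|] := pselect (mingens I m); first exact: covered_id.
  move=> /not_andP[//|/existsNP[m' /not_implyP[Im' /not_implyP[m'm ne]]]].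
  apply: covered_le (m'm) _; apply: IH => //.
  have := mdegD (m - m') m'; rewrite submK // => e.
  have : mdeg (m - m') != 0%N.
    apply: contra_notN ne; rewrite mdeg_eq0 => /eqP z.
    by rewrite -(submK m'm) z add0m.
  by lia.
apply/seteqP; split.
  rewrite [in X in X `<=` _]IA; apply: ideal_gen_sub; first exact: ideal_gen_is_ideal.
  move=> _ [a Aa <-]; apply/midealX; apply: (key (mdeg a).+1) => //.
  by rewrite IA; apply: mem_mideal.
by apply: ideal_gen_sub => // _ [a [Ia _] <-].
Qed.

End MonomialIdeals.

(** * Symbolic powers of monomial ideals *)

Section FDegree.
Context {n : nat}.
Implicit Types (F G : {set 'I_n}) (m u v : 'X_{1..n}) (i j l : 'I_n).

Definition fdeg F m := (\sum_(i in F) m i)%N.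

Lemma fdeg0 F : fdeg F 0%MM = 0%N.
Proof. by rewrite /fdeg big1 // => i _; rewrite mnm0E. Qed.

Lemma fdegD F : {morph fdeg F : u v / (u + v)%MM >-> (u + v)%N}.
Proof.
by move=> u v; rewrite /fdeg -big_split; apply: eq_bigr => i _; rewrite mnmDE.
Qed.

Lemma fdeg1 F i : fdeg F U_(i)%MM = (i \in F).
Proof.
rewrite /fdeg; case: (boolP (i \in F)) => iF.
  rewrite (bigD1 i) //= mnm1E eqxx big1 // => j /andP[_ ji].
  by rewrite mnm1E eq_sym (negbTE ji).
rewrite big1 // => j jF; rewrite mnm1E.
by case: eqP => // e; rewrite e jF in iF.
Qed.

Lemma fdeg_le F u v : (u <= v)%MM -> (fdeg F u <= fdeg F v)%N.
Proof. by move=> /mnm_lepP uv; apply: leq_sum. Qed.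

Lemma fdeg_gt0 F u : (0 < fdeg F u)%N -> exists2 i, i \in F & (0 < u i)%N.
Proof.
rewrite lt0n sum_nat_eq0 => /forallPn [i]; rewrite negb_imply -lt0n.
by case/andP; exists i.
Qed.

End FDegree.

HB.instance Definition _ n (F : {set 'I_n}) :=
  isMeasure.Build n (fdeg F) (fdeg0 F) (fdegD F).

Section SymbolicPowers.
Context {n : nat} {K : fieldType}.
Implicit Types (F G : {set 'I_n}) (m u v : 'X_{1..n}) (i j l : 'I_n).
Implicit Types (f g s : {mpoly K[n]}).

(** This is the [c]-th power of [var_ideal F]: the polynomials that vanish to
    order [c] on the linear subspace where the variables of [F] are zero. *)
Definition ford F c : set {mpoly K[n]} :=
  supported [set m | (c <= fdeg F m)%N].

Lemma ford_ideal F c : is_ideal (ford F c).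
Proof. by apply: supported_ideal => u v /(fdeg_le F) uv /leq_trans; apply. Qed.

Lemma var_ideal_ford F : var_ideal F = ford F 1.
Proof.
rewrite var_idealE midealE; congr supported; apply/seteqP; split=> m.
  by move=> [_ [i iF <-] im]; apply: leq_trans (fdeg_le F im); rewrite fdeg1 iF.
move=> /= /fdeg_gt0 [i iF mi]; exists U_(i)%MM; first by exists i.
by rewrite lep1mP -lt0n.
Qed.

Lemma mcoeff_pihomog (mf : measure n) d f m :
  (pihomog mf d f)@_m = if mf m == d then f@_m else 0.
Proof.
have -> : f@_m = \sum_(m' <- msupp f) f@_m' * (m' == m)%:R.
  by rewrite {1}(mpolyE f) raddf_sum /=; apply: eq_bigr => m' _; rewrite mcoeffZ mcoeffX.
rewrite pihomogE raddf_sum /= big_mkcond.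
case: ifP => md; last rewrite -[RHS](@big1_eq _ _ +%R _ (msupp f) predT).
  apply: eq_bigr => m' _; rewrite mcoeffZ mcoeffX; have [->|_] := eqVneq m' m.
    by rewrite md.
  by rewrite mulr0 if_same.
apply: eq_bigr => m' _; rewrite mcoeffZ mcoeffX; have [->|_] := eqVneq m' m.
  by rewrite md.
by rewrite mulr0 if_same.
Qed.

Lemma ford_pihomog F c f : ford F c f -> ford F c.+1 (f - pihomog (fdeg F) c f).
Proof.
move=> fc m; rewrite mcoeff_msupp mcoeffB mcoeff_pihomog /=.
have [_|mc] := eqVneq (fdeg F m) c; first by rewrite subrr eqxx.
by rewrite subr0 -mcoeff_msupp => /fc /=; rewrite leq_eqVlt eq_sym (negbTE mc).
Qed.

Lemma ford_mul F c e f g : ford F c f -> ford F e g -> ford F (c + e) (f * g).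
Proof.
move=> fc ge m /msuppM_le /allpairsP [[m1 m2] /= [/fc m1c /ge m2e ->]].
by rewrite fdegD leq_add.
Qed.

(** The least [F]-degree of a monomial is additive on products, because the
    product of the two lowest [F]-homogeneous parts is nonzero. *)
Lemma ford_cancel F c f s : ~ ford F 1 s -> ford F c (s * f) -> ford F c f.
Proof.
move=> sF; elim: c => [|c IH] // sf.
have [_ _ FD FM] := ford_ideal F c.+1.
have fc : ford F c f by apply: IH => m /sf; apply: ltnW.
pose s0 := pihomog (fdeg F) 0 s; pose f0 := pihomog (fdeg F) c f.
have s0n : s0 != 0.
  apply: contra_notN sF => /eqP e; have : ford F 0 s by [].
  by move=> /ford_pihomog; rewrite -/s0 e subr0.
have sf0 : ford F c.+1 (s0 * f0).
  have -> : s0 * f0 = s * f + -1 * ((s - s0) * f0 + s * (f - f0)).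
    by ring.
  have f0c : ford F c f0.
    by move=> m; rewrite mcoeff_msupp mcoeff_pihomog /=; have [->|_] := eqVneq (fdeg F m) c; rewrite ?eqxx.
  apply: (FD) => //; apply: (FM) => //; apply: (FD); last exact/(FM)/ford_pihomog.
  by rewrite -add1n; apply: ford_mul => //; apply: ford_pihomog.
have f0z : f0 = 0.
  apply/eqP; have : s0 * f0 == 0.
    rewrite -msupp_eq0; case E: (msupp _) => [//|m l].
    have mE : m \in msupp (s0 * f0) by rewrite E mem_head.
    have := dhomogM (pihomogP (fdeg F) 0 s) (pihomogP (fdeg F) c f).
    move=> /dhomogP/(_ _ mE) mc; have := sf0 _ mE.
    by rewrite /= mc add0n ltnn.
  by rewrite mulf_eq0 (negbTE s0n).
by have := ford_pihomog fc; rewrite -/f0 f0z subr0.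
Qed.

(** Clearing denominators turns membership in the localization into [s * f] being
    of order at least [c] with [s] outside of the prime, and [s] cancels. *)
Lemma loc_contraction_ford F c (J : set {mpoly K[n]}) :
  J `<=` ford F c -> loc_contraction (var_ideal F) J `<=` ford F c.
Proof.
move=> JF f; rewrite /loc_contraction /loc_ideal /= => Jf.
pose P : set {fraction {mpoly K[n]}} := [set x | exists s g,
  [/\ ~ var_ideal F s, ford F c g & x = tofrac g / tofrac s]].
have [_ F0 FD FM] := ford_ideal F c.
have V1 : ~ var_ideal F (1 : {mpoly K[n]}).
  by rewrite var_ideal_ford => /(_ 0%MM); rewrite msupp1 inE eqxx /= fdeg0 => /(_ isT).
have nz s : ~ var_ideal F s -> tofrac s != 0.
  apply: contra_notN; rewrite tofrac_eq0 => /eqP->.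
  by rewrite var_ideal_ford => m; rewrite msupp0.
have VM s t : ~ var_ideal F s -> ~ var_ideal F t -> ~ var_ideal F (s * t).
  by rewrite var_ideal_ford => sF tF stF; apply/tF/ford_cancel/stF.
have : P (tofrac f).
  apply: Jf; split.
    split.
    - move=> _ [s [g [sF gF ->]]]; exists g => //; by exists s.
    - by exists 1, 0; split=> //; rewrite tofrac0 mul0r.
    - move=> _ _ [s [g [sF gF ->]]] [t [h [tF hF ->]]].
      exists (s * t), (t * g + s * h); split; first exact: VM.
        by apply: FD; apply: (FM).
      rewrite tofracD !tofracM addf_div ?nz //.
      by rewrite [tofrac t * _]mulrC [tofrac s * _]mulrC.
    - move=> _ _ [a _ [s sF <-]] [t [g [tF gF ->]]].
      exists (s * t), (a * g); split; [exact: VM | exact: FM |].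
      by rewrite !tofracM mulf_div.
  by move=> _ [g /JF gF <-]; exists 1, g; rewrite tofrac1 divr1.
move=> [s [g [sF gF e]]]; apply: (ford_cancel (s := s)); rewrite -?var_ideal_ford //.
suff -> : s * f = g by [].
apply/eqP; rewrite -tofrac_eq tofracM e mulrC divfK //; exact: nz.
Qed.

Lemma var_ideal_prime F : prime_ideal (var_ideal F : set {mpoly K[n]}).
Proof.
rewrite var_ideal_ford; split; first exact: ford_ideal.
  by move=> /(_ 0%MM); rewrite msupp1 inE eqxx /= fdeg0 => /(_ isT).
move=> a b ab; have [|aF] := pselect (ford F 1 a); first by left.
by right; apply: ford_cancel ab.
Qed.

(** The prime is the annihilator of the monomial [w], whose order along [F] is
    smaller than that of every element of the ideal. *)
Lemma var_ideal_Ass A F w :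
  (forall i, i \in F -> covered A (w + U_(i))%MM) ->
  (forall a, A a -> (fdeg F w < fdeg F a)%N) ->
  Ass (mideal A : set {mpoly K[n]}) (var_ideal F).
Proof.
move=> Aw wA; split; first exact: var_ideal_prime.
exists 'X_[w]; apply/seteqP; split=> f /=.
  rewrite var_ideal_ford => f1; rewrite midealE => m.
  rewrite (perm_mem (msuppMX _ _)) => /mapP [m' /f1 /= /fdeg_gt0[i iF mi] ->].
  apply: covered_le (Aw i iF); apply: lem_add2 (lepm_refl _) _.
  by rewrite lep1mP -lt0n.
have AF : mideal A `<=` ford F (fdeg F w).+1.
  apply: supported_mideal => //.
  by move=> u v /(fdeg_le F) uv /leq_trans; apply.
move=> /AF h; rewrite var_ideal_ford => m mf.
have /h : (w + m)%MM \in msupp (f * 'X_[w]).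
  by rewrite (perm_mem (msuppMX _ _)) map_f.
by rewrite /= fdegD -addn1 leq_add2l.
Qed.

(** Each [var_ideal F] below is an associated prime of [mideal A], and the
    [k]-th power of [mideal A] lies in the primary ideal of the polynomials of
    [F]-order at least [k * c]; the hypothesis says that these primary ideals
    cut out that power. *)
Lemma symbolic_power_mideal A k :
  (forall u, ~ covered (mpow A k) u -> exists F w c,
     [/\ forall i, i \in F -> covered A (w + U_(i))%MM,
         (fdeg F w < c)%N, forall a, A a -> (c <= fdeg F a)%N
       & (fdeg F u < k * c)%N]) ->
  symbolic_power (mideal A : set {mpoly K[n]}) k = ideal_pow (mideal A) k.
Proof.
move=> H; apply/seteqP; split; last first.
  move=> f fI P _; apply: sub_gen_smallest; by exists f.
move=> f fI; rewrite mideal_pow midealE => u uf.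
have [//|/H [F [w [c [Aw wc cA uF]]]]] := pselect (covered (mpow A k) u).
have wA a : A a -> (fdeg F w < fdeg F a)%N by move=> /cA; apply: leq_trans.
have /loc_contraction_ford := fI _ (var_ideal_Ass Aw wA).
rewrite mideal_pow => /(_ (k * c)%N) h.
suff /h/(_ u uf) : mideal (mpow A k) `<=` ford F (k * c)%N.
  by rewrite /= leqNgt uF.
apply: supported_mideal => [u' v /(fdeg_le F) uv /leq_trans|]; first by apply.
elim: {+}k => [|k' IH] //= _ [a /cA ca [b /IH /= cb <-]].
by rewrite fdegD mulSn leq_add.
Qed.

End SymbolicPowers.

(** * Linear quotients from the exchange property *)

Section Exchange.
Context {n : nat}.
Implicit Types (A B : set 'X_{1..n}) (m u v : 'X_{1..n}) (i j l : 'I_n).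

Definition equidegree d B := forall u, B u -> mdeg u = d.

Definition exchange B := forall u v, B u -> B v -> forall i, (v i < u i)%N ->
  exists2 j, (u j < v j)%N & B (u - U_(i) + U_(j))%MM.

Lemma mdeg_trade u i j : (0 < u i)%N -> mdeg (u - U_(i) + U_(j))%MM = mdeg u.
Proof.
move=> ui; have iu : (U_(i) <= u)%MM by rewrite lep1mP -lt0n.
by rewrite mdegD mdeg1 -[in RHS](submK iu) mdegD mdeg1.
Qed.

(** Lowering [u] at the first place where [u] and [v] differ, and raising it at
    a place that is necessarily later, produces a smaller exponent. *)
Lemma exchange_below d B u v :
  equidegree d B -> exchange B -> B u -> B v -> (v < u)%O ->
  exists i j, [/\ (u j < v j)%N, (0 < u i)%N, B (u - U_(i) + U_(j))%MM
                & (u - U_(i) + U_(j) < u)%O%MM].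
Proof.
move=> Bd Bx Bu Bv; have uv : mdeg v = mdeg u by rewrite !Bd.
case/(ltmcP uv) => i eqvu vui.
have [j uvj Bw] := Bx u v Bu Bv i vui; have ui : (0 < u i)%N by lia.
exists i, j; split=> //; apply/ltmcP; first exact: mdeg_trade.
have ij : (i < j)%N.
  by rewrite ltn_neqAle; apply/andP; split; [apply: contraTneq uvj => /val_inj <- |rewrite leqNgt; apply: contraTN uvj => /eqvu ->]; lia.
exists i => [l li|]; rewrite mnmDE mnmBE !mnm1E.
  have -> : (i == l) = false by apply/negbTE/eqP => e; rewrite e ltnn in li.
  have -> : (j == l) = false by apply/negbTE/eqP => e; rewrite e in ij; lia.
  by lia.
have -> : (j == i) = false by apply/negbTE/eqP => e; rewrite e ltnn in ij.
by rewrite eqxx; lia.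
Qed.

(** Exponents of degree [d] are finite in number, so that a set of them can be
    listed in increasing order. *)
Definition base_seq d B : seq 'X_{1..n} :=
  sort <=%O (map (@bmnm n d.+1) [seq m <- index_enum _ | `[< B (bmnm m) >]]).

Lemma base_seq_uniq d B : uniq (base_seq d B).
Proof.
rewrite sort_uniq map_inj_uniq; last exact: val_inj.
by rewrite filter_uniq // index_enum_uniq.
Qed.

Lemma mem_base_seq d B m : equidegree d B -> (m \in base_seq d B) <-> B m.
Proof.
move=> Bd; rewrite mem_sort; split=> [/mapP[m']|Bm].
  by rewrite mem_filter => /andP[/asboolP ? _ ->].
have md : (mdeg m < d.+1)%N by rewrite (Bd _ Bm).
apply/mapP; exists (BMultinom md) => //.
by rewrite mem_filter mem_index_enum andbT; apply/asboolP.
Qed.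

Lemma mem_take_base_seq d B (i : nat) v : (i < size (base_seq d B))%N ->
  v \in take i (base_seq d B) =
  (v \in base_seq d B) && (v < nth 0%MM (base_seq d B) i)%O.
Proof.
move=> il; have [vB|] := boolP (v \in base_seq d B); last first.
  by apply: contraNF; apply: mem_take.
rewrite in_take //= -[in RHS](nth_index 0%MM vB).
have srt : sorted <%O (base_seq d B).
  by rewrite lt_sorted_uniq_le base_seq_uniq sort_sorted //; apply: le_total.
by rewrite lt_sorted_ltn_nth // inE ?index_mem.
Qed.

Context {K : fieldType}.

(** If an earlier [v] divides [u * m], then [exchange_below] finds a variable [x_j]
    dividing [m] such that [u * x_j] is divisible by an earlier generator. *)
Lemma colon_exchange d B u (L := [set v | B v /\ (v < u)%O]) :
  equidegree d B -> exchange B -> B u ->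
  colon (mideal L) (ideal_gen [set 'X_[K, u]]) =
  var_ideal [set j : 'I_n | `[< covered L (u + U_(j))%MM >]]%SET.
Proof.
move=> Bd Bx Bu; set F := finset _.
have LI : is_ideal (mideal L : set {mpoly K[n]}) by apply: mideal_is_ideal.
apply/seteqP; split=> f; last first.
  move=> fF; apply/(mem_colon_principal _ _ LI).
  rewrite midealE => m; rewrite (perm_mem (msuppMX _ _)) => /mapP [m' m'f ->].
  move: fF; rewrite var_idealE midealE => /(_ _ m'f) [_ [j jF <-] jm].
  have : covered L (u + U_(j))%MM by move: jF; rewrite /= inE => /asboolP.
  by apply: covered_le; apply: lem_add2 jm; apply: lepm_refl.
move=> /(mem_colon_principal _ _ LI).
rewrite var_idealE !midealE => h m mf.
have /h [v [Bv vu] vm] : (u + m)%MM \in msupp (f * 'X_[u]).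
  by rewrite (perm_mem (msuppMX _ _)) map_f.
have [i [j [uvj ui Bw wu]]] := exchange_below Bd Bx Bu Bv vu.
have mj : (0 < m j)%N by move/mnm_lepP: vm => /(_ j); rewrite mnmDE; lia.
exists U_(j)%MM; last by rewrite lep1mP -lt0n.
exists j => //=; rewrite inE; apply/asboolP; exists (u - U_(i) + U_(j))%MM => //.
by apply: lem_add2; [apply: lem_subr | apply: lepm_refl].
Qed.

Lemma take_base_seq_set d B (i : nat) : equidegree d B -> (i < size (base_seq d B))%N ->
  [set` take i (base_seq d B)] =
  [set v | B v /\ (v < nth 0%MM (base_seq d B) i)%O].
Proof.
move=> Bd il; apply/seteqP; split=> v /=; rewrite mem_take_base_seq //.
  by case/andP => /(mem_base_seq _ Bd).
by case=> /(mem_base_seq _ Bd) -> ->.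
Qed.

Lemma colon_base_seq d B (i : nat) (s := base_seq d B) :
  equidegree d B -> exchange B -> (i < size s)%N ->
  exists F : {set 'I_n}, colon (mideal [set` take i s])
    (ideal_gen [set 'X_[K, nth 0%MM s i]]) = var_ideal F.
Proof.
move=> Bd Bx il; rewrite take_base_seq_set //; eexists.
by apply: colon_exchange (Bd) (Bx) _; apply/(mem_base_seq _ Bd)/mem_nth.
Qed.

Lemma linear_quotients_exchange d B : equidegree d B -> exchange B ->
  linear_quotients (mideal B : set {mpoly K[n]}).
Proof.
move=> Bd Bx; split; first by exists B.
exists (base_seq d B); split; first exact: base_seq_uniq.
  by rewrite (mingens_mideal Bd); apply/seteqP; split=> m /(mem_base_seq _ Bd).
by move=> i /andP[_ il]; have [F HF] := colon_base_seq Bd Bx il; exists F; rewrite -HF.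
Qed.

End Exchange.

(** * Linear resolutions by iterated mapping cones *)

(** A comparison map of complexes is lifted one degree at a time: each lift exists
    because the previous one satisfies an invariant [S], and is tied to it by
    [R]. *)
Lemma dependent_sequence (T : nat -> Type) (S : forall i, T i -> Prop)
    (R : forall i, T i -> T i.+1 -> Prop) (x0 : T 0) :
  S 0 x0 -> (forall i x, S i x -> exists2 y, S i.+1 y & R i x y) ->
  exists2 f : forall i, T i, f 0 = x0 & forall i, S i (f i) /\ R i (f i) (f i.+1).
Proof.
move=> S0 step.
pose next i (x : {x : T i | S i x}) : {y : T i.+1 | S i.+1 y} :=
  let c := cid2 (step i _ (projT2 x)) in exist _ (s2val c) (s2valP c).
pose f := fix f i : {x : T i | S i x} :=
  if i is j.+1 then next j (f j) else exist _ x0 S0.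
exists (fun i => projT1 (f i)) => // i; split; first exact: projT2 (f i).
exact: s2valP' (cid2 (step i _ (projT2 (f i)))).
Qed.

Section LinearResolutions.
Context {n : nat} {K : fieldType}.
Local Notation S := {mpoly K[n]}.

Definition mx_homog d a b (A : 'M[S]_(a, b)) := forall i j, A i j \is d.-homog.

Definition exact_at a b c (A : 'M[S]_(a, b)) (B : 'M[S]_(b, c)) :=
  range (fun w : 'rV_a => w *m A) = [set v | v *m B = 0].

Lemma exact_atP a b c (A : 'M[S]_(a, b)) (B : 'M[S]_(b, c)) :
  exact_at A B <->
  A *m B = 0 /\ forall v : 'rV_b, v *m B = 0 -> exists w, v = w *m A.
Proof.
split=> [AB | [AB ker]].
  split=> [|v vB]; last first.
    have : [set v : 'rV_b | v *m B = 0] v by [].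
    by rewrite -AB => -[w _ <-]; exists w.
  apply/row_matrixP => i; rewrite row_mul row0.
  have : range (fun w : 'rV_a => w *m A) (row i A).
    by exists (delta_mx 0 i) => //; rewrite rowE.
  by rewrite AB.
apply/seteqP; split=> v /=; first by move=> [w _ <-]; rewrite -mulmxA AB mulmx0.
by move=> /ker [w ->]; exists w.
Qed.

Lemma pihomogM e c (p q : S) :
  q \is c.-homog -> pihomog mdeg (e + c) (p * q) = pihomog mdeg e p * q.
Proof.
move=> qc; pose N := maxn e.+1 (msize p).
rewrite {1}(pihomog_partitionE (leq_maxr e.+1 (msize p))) -/N.
have eN : (e < N)%N by rewrite leq_max ltnSn.
rewrite mulr_suml raddf_sum (bigD1 (Ordinal eN)) //= big1 ?addr0 => [|i ie].
  by apply/pihomog_dE/dhomogM => //; apply: pihomogP.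
apply: (@pihomog_ne0 _ _ mdeg (i + c)%N).
  by rewrite eqn_add2r.
by apply: dhomogM => //; apply: pihomogP.
Qed.

Lemma mx_homog_mul d e a b c (A : 'M[S]_(a, b)) (B : 'M[S]_(b, c)) :
  mx_homog d A -> mx_homog e B -> mx_homog (d + e) (A *m B).
Proof. by move=> Ad Be i j; rewrite mxE; apply: rpred_sum => k _; apply: dhomogM. Qed.

(** A factorization of a homogeneous matrix through a homogeneous matrix can be
    replaced by its part of the expected degree. *)
Lemma mx_homog_lift d e a b c (M : 'M[S]_(a, c)) (W : 'M_(a, b)) (A : 'M_(b, c)) :
  mx_homog (d + e) M -> mx_homog e A -> W *m A = M ->
  exists2 W' : 'M_(a, b), mx_homog d W' & W' *m A = M.
Proof.
move=> Md Ae WA; exists (map_mx (pihomog mdeg d) W).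
  by move=> i j; rewrite mxE; apply: pihomogP.
apply/matrixP => i j; rewrite -[RHS](pihomog_dE (Md i j)) -WA !mxE raddf_sum /=.
by apply: eq_bigr => k _; rewrite mxE (pihomogM _ _ (Ae k j)).
Qed.

Lemma mx_rows_exist a b (P : 'I_a -> 'rV[S]_b -> Prop) :
  (forall i, exists w, P i w) -> exists W : 'M_(a, b), forall i, P i (row i W).
Proof.
move=> /choice [f Pf]; exists (\matrix_i f i) => i.
by rewrite rowK.
Qed.

Lemma exact_lift e a b c m (A : 'M[S]_(a, b)) (B : 'M_(b, c)) (M : 'M_(m, b)) :
  exact_at A B -> mx_homog 1 A -> mx_homog (e + 1) M -> M *m B = 0 ->
  exists2 W : 'M_(m, a), mx_homog e W & W *m A = M.
Proof.
move=> /exact_atP [_ ker] A1 Me MB.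
have [W WA] : exists W : 'M_(m, a), forall i, row i M = row i W *m A.
  apply: (@mx_rows_exist _ _ (fun i w => row i M = w *m A)) => i; apply: ker.
  by rewrite -row_mul MB row0.
apply: mx_homog_lift Me A1 _.
apply/row_matrixP => i; rewrite row_mul; exact/esym/WA.
Qed.

Lemma exact_cone a2 a1 a0 b2 b1 b0 (A1 : 'M[S]_(a2, a1)) (A0 : 'M_(a1, a0))
    (B1 : 'M_(b2, b1)) (B0 : 'M_(b1, b0)) (f1 : 'M_(b2, a1)) (f0 : 'M_(b1, a0)) :
  exact_at A1 A0 -> exact_at B1 B0 -> f1 *m A0 = - (B1 *m f0) ->
  exact_at (block_mx A1 0 f1 B1) (block_mx A0 0 f0 B0).
Proof.
move=> /exact_atP [A10 kerA] /exact_atP [B10 kerB] f10.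
apply/exact_atP; split.
  by rewrite mulmx_block A10 B10 !mul0mx !mulmx0 !addr0 f10 addNr block_mx0.
move=> v; rewrite -[v]hsubmxK; set v1 := lsubmx v; set v2 := rsubmx v.
rewrite mul_row_block mulmx0 add0r -[0 in RHS]row_mx0 => /eq_row_mx [e1 /kerB[w ew]].
have /kerA [z ez] : (v1 - w *m f1) *m A0 = 0.
  by rewrite mulmxBl -mulmxA f10 mulmxN opprK mulmxA -ew.
exists (row_mx z w); rewrite mul_row_block mulmx0 add0r -ew -ez.
by rewrite subrK.
Qed.

(** A linear resolution with generators in degree [d]. The shifts are determined
    by [d], and linearity says that the maps [D i] have linear entries, which
    implies minimality; this is the form in which mapping cones are built. *)
Definition linres d (I : set S) := exists (r : nat -> nat)
    (a : 'cV[S]_(r 0)) (D : forall i, 'M[S]_(r i.+1, r i)),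
  [/\ mx_homog d a, forall i, mx_homog 1 (D i),
      range (fun v : 'rV_(r 0) => (v *m a) 0 0) = I,
      exact_at (D 0) a & forall i, exact_at (D i.+1) (D i)].

Lemma linres_linear_resolution d I : linres d I -> linear_resolution I.
Proof.
move=> [r [a [D [ah Dh aI e0 e]]]]; exists d.
exists (FreeComplex (fun i (_ : 'I_(r i)) => (d + i)%N) a D); split=> //.
split; last 1 first.
- move=> i p q /=; apply: (dhomog_nemf_coeff (Dh i p q)).
  by rewrite /= mdeg0.
- split=> [p|i p q] /=; first by rewrite addn0; apply: ah.
  by right; exists 1%N; [rewrite addnS addn1 | apply: Dh].
by split.
Qed.

Lemma linres0 d : linres d ([set 0] : set S).
Proof.
exists (fun=> 0%N), 0, (fun=> 0); split.
- by case.
- by move=> i [].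
- apply/seteqP; split=> [_ [v _ <-]|_ ->] /=; first by rewrite mulmx0 mxE.
  by exists 0 => //; rewrite mulmx0 mxE.
- by apply/exact_atP; split=> [|v _]; [rewrite mulmx0 | exists 0; rewrite [v]thinmx0 [RHS]thinmx0].
- by move=> i; apply/exact_atP; split=> [|v _]; [rewrite mulmx0 | exists 0; rewrite [v]thinmx0 [RHS]thinmx0].
Qed.

(** The cone of a lift of multiplication by [u] from a resolution of [J : u] to
    one of [J] resolves [J + (u)], by [0 -> S/(J : u) -> S/J -> S/(J + (u)) -> 0].
    Since [u] has the degree of the generators of [J], and [J : u] is generated
    by linear forms, the lift has entries of degree 1 and linearity persists. *)
Lemma linres_cone d (J Q I : set S) (u : S) :
  linres d J -> linres 1 Q -> u \is d.-homog ->
  (forall f, Q f <-> J (f * u)) ->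
  (forall f, I f <-> exists g h : S, J g /\ f = g + h * u) -> linres d I.
Proof.
move=> [rC [aC [DC [aCh DCh aCJ eC0 eC]]]] [rD [aD [DD [aDh DDh aDQ eD0 eD]]]].
move=> uh Qu Iu.
(* The complexes augmented by [S] in position 0. The cone is the direct sum of
   [C] and of the augmented [D], in which the modules of [D] move up by one. *)
pose rC' i := if i is j.+1 then rC j else 1%N.
pose C' i : 'M[S]_(rC i, rC' i) :=
  match i return 'M_(rC i, rC' i) with 0 => aC | j.+1 => DC j end.
pose rD' i := if i is j.+1 then rD j else 1%N.
pose D' i : 'M[S]_(rD' i.+1, rD' i) :=
  match i return 'M_(rD' i.+1, rD' i) with 0 => aD | j.+1 => DD j end.
have eC' i : exact_at (DC i) (C' i) by case: i.
have eD' i : exact_at (D' i.+1) (D' i) by case: i.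
have D'h i : mx_homog 1 (D' i) by case: i.
have [f0 f0h f0E] : exists2 f0 : 'M_(rD 0, rC 0), mx_homog 1 f0 &
    f0 *m aC = - (aD *m u%:M).
  have [W WE] : exists W : 'M_(rD 0, rC 0), forall i,
      (row i W *m aC) 0 0 = - (aD i 0 * u).
    apply: (@mx_rows_exist _ _ (fun i w => (w *m aC) 0 0 = - (aD i 0 * u))) => i.
    have /Qu : Q (aD i 0).
      rewrite -aDQ; exists (delta_mx 0 i) => //.
      by rewrite -rowE mxE.
    rewrite -aCJ => -[w _ ew]; exists (- w).
    by rewrite mulNmx mxE ew.
  apply: (@mx_homog_lift 1 d _ _ _ _ W).
  - move=> i j; rewrite mul_mx_scalar mxE mxE rpredN addnC.
    exact: dhomogM uh (aDh i j).
  - by [].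
  apply/matrixP => i j; rewrite !ord1; have := WE i.
  by rewrite -row_mul mxE => ->; rewrite mul_mx_scalar !mxE mulrC.
(* The invariant makes the rows to be lifted cycles; the maps anticommute with
   the differentials, so that the block matrices compose to zero. *)
pose St i (f : 'M[S]_(rD' i.+1, rC i)) :=
  mx_homog 1 f /\ D' i.+1 *m f *m C' i = 0.
pose Re i (f : 'M[S]_(rD' i.+1, rC i)) (g : 'M[S]_(rD' i.+2, rC i.+1)) :=
  g *m DC i = - (D' i.+1 *m f).
have St0 : St 0%N f0.
  split=> //=; rewrite -mulmxA f0E mulmxN mulmxA.
  by have /exact_atP[-> _] := eD0; rewrite mul0mx oppr0.
have step i f : St i f -> exists2 g, St i.+1 g & Re i f g.
  move=> [fh fE].
  have [g gh gE] : exists2 g : 'M_(_, _), mx_homog 1 g & g *m DC i = - (D' i.+1 *m f).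
    apply: exact_lift (eC' i) (DCh i) _ _.
      by move=> p q; rewrite mxE rpredN; apply: (mx_homog_mul (D'h _) fh).
    by rewrite mulNmx fE oppr0.
  exists g => //; split=> //=; rewrite -mulmxA gE mulmxN mulmxA.
  by have /exact_atP[-> _] := eD' i.+1; rewrite mul0mx oppr0.
have [f f0' fP] := dependent_sequence St0 step.
exists (fun i => rC i + rD' i)%N, (col_mx aC u%:M),
  (fun i => block_mx (DC i) 0 (f i) (D' i)); split.
- move=> i j; rewrite mxE; case: splitP => k _; first exact: aCh.
  by rewrite !ord1 mxE mulr1n.
- move=> i p q; rewrite mxE; case: splitP => k _; rewrite mxE; case: splitP => l _.
  + exact: DCh.
  + by rewrite mxE rpred0.
  + by have [[+ _] _] := fP i; apply.
  + exact: D'h.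
- apply/seteqP; split=> g /=.
    move=> [v _ <-]; rewrite -[v]hsubmxK mul_row_col mxE.
    apply/Iu; exists ((lsubmx v *m aC) 0 0), (rsubmx v 0 0); split.
      by rewrite -aCJ; exists (lsubmx v).
    by congr (_ + _); rewrite mul_mx_scalar mxE mulrC.
  move=> /Iu [g1 [h [+ ->]]]; rewrite -aCJ => -[v _ <-].
  exists (row_mx v h%:M) => //; rewrite mul_row_col mxE.
  by congr (_ + _); rewrite mul_mx_scalar !mxE mulr1n mulrC.
- have /exact_atP[zC kC] := eC0; apply/exact_atP; split.
    by rewrite mul_block_col zC mul0mx addr0 f0' f0E addNr col_mx0.
  move=> v; rewrite -[v]hsubmxK; set v1 := lsubmx v; set v2 := rsubmx v.
  rewrite mul_row_col => ev.
  have : Q (v2 0 0).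
    apply/Qu; rewrite -aCJ; exists (- v1) => //.
    move/eqP: ev; rewrite mulNmx addr_eq0 => /eqP->.
    by rewrite mul_mx_scalar opprK mxE mulrC.
  rewrite -aDQ => -[w _ ew].
  have ev2 : v2 = w *m aD by apply/matrixP => i j; rewrite !ord1 ew.
  have /kC [z ez] : (v1 - w *m f 0%N) *m aC = 0.
    by rewrite mulmxBl -mulmxA f0' f0E mulmxN opprK mulmxA -ev2.
  exists (row_mx z w); rewrite mul_row_block mulmx0 add0r -ez /= -ev2.
  by rewrite subrK.
- by move=> i; apply: exact_cone => //; have [_ ->] := fP i.
Qed.

Lemma mideal_set0 : mideal set0 = [set 0 : S].
Proof.
apply/seteqP; split=> f; last by move=> ->; case: (@mideal_is_ideal n K set0).
rewrite midealE => f0; apply/eqP; rewrite -msupp_eq0.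
case E: (msupp f) => [//|m l]; have /f0 [? []] : m \in msupp f.
by rewrite E mem_head.
Qed.

Lemma mideal_setU1 A u (f : S) :
  mideal (A `|` [set u]) f <-> exists g h : S, mideal A g /\ f = g + h * 'X_[u].
Proof.
have [_ A0 AD AM] := @mideal_is_ideal n K A.
have [_ _ UD UM] := @mideal_is_ideal n K (A `|` [set u]).
split=> [|[g [h [Ag ->]]]]; last first.
  apply: (UD); last by apply: UM => //; apply: mem_mideal; right.
  move: g Ag; apply: ideal_gen_sub; first exact: mideal_is_ideal.
  by move=> _ [a Aa <-]; apply: mem_mideal; left.
suff : mideal (A `|` [set u]) `<=`
  [set f : S | exists g h : S, mideal A g /\ f = g + h * 'X_[u]] by apply.
apply: ideal_gen_sub; first split => //.
- by exists 0, 0; rewrite mul0r addr0.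
- move=> _ _ [g1 [h1 [g1A ->]]] [g2 [h2 [g2A ->]]].
  by exists (g1 + g2), (h1 + h2); split; [apply: AD | rewrite mulrDl addrACA].
- move=> a _ _ [g [h [gA ->]]].
  by exists (a * g), (a * h); split; [apply: AM | rewrite mulrDr mulrA].
- move=> _ [a [Aa|->] <-].
    by exists 'X_[a], 0; rewrite mul0r addr0; split=> //; apply: mem_mideal.
  by exists 0, 1; rewrite mul1r add0r.
Qed.

Lemma linres_setU1 d A u (F : {set 'I_n}) :
  linres d (mideal A) -> linres 1 (var_ideal F) -> mdeg u = d ->
  (forall f : S, var_ideal F f <-> mideal A (f * 'X_[u])) ->
  linres d (mideal (A `|` [set u])).
Proof.
move=> Ad F1 ud Fu; apply: linres_cone Ad F1 _ Fu (@mideal_setU1 A u).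
by rewrite dhomogX /= ud.
Qed.

(** Since [var_ideal F : x_j] is [var_ideal F] for [j] outside of [F], adjoining the
    variables one at a time builds the Koszul complex. *)
Lemma linres_var_ideal (F : {set 'I_n}) : linres 1 (var_ideal F).
Proof.
rewrite -[F]set_enum; elim: (enum F) (enum_uniq F) => {F} [_|j s IH /= /andP[js us]].
  have -> : var_ideal [set x in [::]]%SET = [set 0 : S].
    rewrite var_idealE -mideal_set0; congr mideal; apply/seteqP; split=> // m.
    by move=> [i]; rewrite /= inE.
  exact: linres0.
set F := [set x in s]%SET; have FE : var_ideal [set x in j :: s]%SET =
    mideal ([set U_(i)%MM | i in [set` F]] `|` [set U_(j)%MM]) :> set S.
  rewrite var_idealE; congr mideal; apply/seteqP; split=> m.
    move=> [i]; rewrite /= !inE => /orP[/eqP-> <-|si <-]; [by right|left].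
    by exists i => //; rewrite /= inE.
  move=> [[i + <-]|->].
    by rewrite /= inE => si; exists i => //; rewrite /= !inE si orbT.
  by exists j => //; rewrite /= !inE eqxx.
rewrite FE; apply: (@linres_setU1 _ _ _ F); rewrite -?var_idealE ?mdeg1 //; try exact: IH.
move=> f; rewrite var_ideal_ford; split=> [fF|].
  by rewrite mulrC; have [_ _ _ FM] := @ford_ideal n K F 1; apply: FM.
rewrite mulrC; apply: ford_cancel => /(_ U_(j)%MM).
by rewrite msuppX inE eqxx /= fdeg1 inE (negbTE js) => /(_ isT).
Qed.

Lemma linres_exchange d B :
  equidegree d B -> exchange B -> linres d (mideal B).
Proof.
move=> Bd Bx; set s := base_seq d B.
have sB : [set` s] = B by apply/seteqP; split=> m /(mem_base_seq _ Bd).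
suff H i : (i <= size s)%N -> linres d (mideal [set` take i s]).
  by have := H _ (leqnn _); rewrite take_size sB.
elim: i => [_|i IH si].
  have -> : [set` take 0 s] = set0 by rewrite take0; apply/seteqP; split.
  by rewrite mideal_set0; apply: linres0.
have [F HF] := colon_base_seq (K := K) Bd Bx si.
have -> : [set` take i.+1 s] = [set` take i s] `|` [set nth 0%MM s i].
  rewrite (take_nth 0%MM si); apply/seteqP; split=> m /=.
    by rewrite mem_rcons inE => /orP[/eqP->|]; [right | left].
  by rewrite mem_rcons inE => -[->|->]; rewrite ?eqxx ?orbT.
apply: (@linres_setU1 _ _ _ F); [exact/IH/ltnW | exact: linres_var_ideal | |].
  exact/Bd/(mem_base_seq _ Bd)/mem_nth.
by move=> f; rewrite -HF; apply/mem_colon_principal/mideal_is_ideal.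
Qed.

End LinearResolutions.

(** * Products with ideals of variables *)

Section Simplex.
Context {n : nat}.
Implicit Types (A B : set 'X_{1..n}) (m u v w : 'X_{1..n}) (i j l : 'I_n).
Implicit Types (F : {set 'I_n}).

Definition simplex F : set 'X_{1..n} := [set U_(i)%MM | i in [set` F]].

Lemma simplex_mdeg F : equidegree 1 (simplex F).
Proof. by move=> _ [i _ <-]; rewrite mdeg1. Qed.

Lemma mem_simplex F i : i \in F -> simplex F U_(i)%MM.
Proof. by move=> iF; exists i. Qed.

(** The case of [exchange_msum_simplex] in which the letter [i] to be traded is
    the one that was added to the base [w]. Either [l'] can replace it, or [w]
    exceeds [b'] at [l'], where an exchange in [B] frees a letter [l']. *)
Lemma exchange_letter B F w b' l' i :
  exchange B -> B w -> B b' -> l' \in F -> ((b' + U_(l'))%MM i <= w i)%N ->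
  exists2 j, ((w + U_(i))%MM j < (b' + U_(l'))%MM j)%N &
    msum B (simplex F) (w + U_(j))%MM.
Proof.
move=> Bx Bw Bb' l'F; rewrite mnmDE mnm1E => le.
have [wl|wl] := leqP (w l') (b' l').
  exists l'; last by exists w => //; exists U_(l')%MM => //; apply: mem_simplex.
  rewrite !mnmDE !mnm1E eqxx; case: (eqVneq i l') => [e|]; last by lia.
  by move: le; rewrite e eqxx; lia.
have [j wj Bj] := Bx w b' Bw Bb' l' wl.
exists j.
  rewrite !mnmDE !mnm1E; case: (eqVneq i j) => [e|]; last by lia.
  by move: le; rewrite e; lia.
exists (w - U_(l') + U_(j))%MM => //; exists U_(l')%MM; first exact: mem_simplex.
apply/mnmP => x; rewrite !mnmDE !mnmBE !mnm1E.
by case: (eqVneq l' x) => [<-|]; lia.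
Qed.

(** Unless [i] is the added letter, exchange inside [B]. The resulting index [j]
    fails to be deficient for the sum only if [j] is the letter added to [b], and
    then the sum can be rewritten with [i] as the added letter. *)
Lemma exchange_msum_simplex B F : exchange B -> exchange (msum B (simplex F)).
Proof.
move=> Bx _ _ [b Bb [_ [l lF <-] <-]] [b' Bb' [_ [l' l'F <-] <-]] i ui.
have [e|li] := eqVneq l i.
  rewrite e in ui *; have [|j uj Bj] := @exchange_letter B F b b' l' i Bx Bb Bb' l'F.
    by move: ui; rewrite !mnmDE !mnm1E eqxx; lia.
  by exists j => //; rewrite addmK.
have bi : (b' i < b i)%N by move: ui; rewrite !mnmDE !mnm1E (negbTE li); lia.
have [j bj Bw] := Bx b b' Bb Bb' i bi; set w := (b - U_(i) + U_(j))%MM in Bw.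
have [uj|uj] := ltnP ((b + U_(l))%MM j) ((b' + U_(l'))%MM j).
  exists j => //; exists w => //; exists U_(l)%MM; first exact: mem_simplex.
  apply/mnmP => x; rewrite /w !mnmDE !mnmBE !mnmDE !mnm1E.
  by case: (eqVneq i x) => [<-|]; lia.
have e : l = j.
  apply/eqP; apply: contraLR uj => lj; rewrite -ltnNge !mnmDE !mnm1E (negbTE lj).
  by lia.
have wu : (w + U_(i) = b + U_(l))%MM.
  apply/mnmP => x; rewrite /w e !mnmDE !mnmBE !mnm1E.
  by case: (eqVneq i x) => [<-|]; lia.
have [|j' uj' Bj'] := @exchange_letter B F w b' l' i Bx Bw Bb' l'F.
  move: ui; rewrite /w !mnmDE !mnmBE !mnm1E (negbTE li) eqxx.
  by lia.
by exists j'; rewrite -wu // addmK.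
Qed.

Lemma exchange0 : exchange [set (0 : 'X_{1..n})%MM].
Proof. by move=> u v -> -> i; rewrite ltnn. Qed.

Lemma mdeg_fdegT m : mdeg m = fdeg [set: 'I_n]%SET m.
Proof. by rewrite mdegE; apply: eq_bigl => i; rewrite inE. Qed.

Definition component A e : set 'X_{1..n} := [set m | mdeg m = e /\ covered A m].

Lemma component_equidegree A e : equidegree e (component A e).
Proof. by move=> u []. Qed.

Lemma componentS A d e : equidegree d A -> (d <= e)%N ->
  component A e.+1 = msum (component A e) (simplex [set: 'I_n]%SET).
Proof.
move=> Ad de; apply/seteqP; split=> m; last first.
  move=> [u [ue uA] [_ [i _ <-] <-]]; split; first by rewrite mdegD mdeg1 ue addn1.
  by apply: covered_le uA; apply: lem_addr.
move=> [me [a Aa am]]; have : (0 < fdeg [set: 'I_n]%SET (m - a)%MM)%N.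
  rewrite -mdeg_fdegT; have := mdegD (m - a) a; rewrite submK // me (Ad _ Aa).
  by lia.
move=> /fdeg_gt0 [i _]; rewrite mnmBE => mai.
have im : (U_(i) <= m)%MM by rewrite lep1mP; lia.
exists (m - U_(i))%MM; last by exists U_(i)%MM; [apply: mem_simplex; rewrite inE | exact: submK].
split; first by have := mdegD (m - U_(i)) U_(i); rewrite submK // mdeg1 me; lia.
exists a => //; apply/mnm_lepP => x; rewrite mnmBE mnm1E.
by move/mnm_lepP: am => /(_ x); case: (eqVneq i x) => [<-|]; lia.
Qed.

Lemma exchange_component A d e :
  equidegree d A -> exchange A -> exchange (component A e).
Proof.
move=> Ad Ax; have [ed|] := ltnP e d.
  move=> u v [ue [a Aa au]]; have := lemc_mdeg (lem_leo au).
  by rewrite ue (Ad _ Aa) leqNgt ed.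
move=> /subnKC <-; elim: (e - d)%N => [|k IH].
  rewrite addn0; suff -> : component A d = A by [].
  apply/seteqP; split=> m; first by move=> [md]; apply: covered_eq md.
  by move=> Am; split; [apply: Ad | apply: covered_id].
rewrite addnS (componentS Ad (leq_addr _ _)).
exact: exchange_msum_simplex.
Qed.

Context {K : fieldType}.

Lemma mideal_graded A : graded_ideal (mideal A : set {mpoly K[n]}).
Proof.
split; first exact: mideal_is_ideal.
move=> f; rewrite midealE => fA d m; rewrite mcoeff_msupp mcoeff_pihomog.
by case: ifP => _; [rewrite -mcoeff_msupp; apply: fA | rewrite eqxx].
Qed.

Lemma degree_component_mideal A e :
  degree_component_ideal (mideal A) e = mideal (component A e) :> set {mpoly K[n]}.
Proof.
apply/seteqP; split; apply: ideal_gen_sub; try exact: ideal_gen_is_ideal.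
  move=> f [+ /dhomogP fe]; rewrite !midealE => fA m mf; exists m; last exact: lepm_refl.
  by split; [apply: fe | apply: fA].
move=> _ [m [me mA] <-]; apply: sub_gen_smallest.
by split; [apply/midealX | rewrite dhomogX /= me].
Qed.

Lemma componentwise_linear_exchange A d : equidegree d A -> exchange A ->
  componentwise_linear (mideal A : set {mpoly K[n]}).
Proof.
move=> Ad Ax; split; first exact: mideal_graded.
move=> e; rewrite degree_component_mideal.
apply: (@linres_linear_resolution _ _ e); apply: linres_exchange.
  exact: component_equidegree.
exact: exchange_component Ad Ax.
Qed.

End Simplex.

(** * Transversal polymatroidal ideals *)

Section MinkowskiMonoid.
Context {n : nat}.

Lemma msumA : associative (@msum n).
Proof.
move=> A B C; apply/seteqP; split=> [_ [a Aa [_ [b Bb [c Cc <-]] <-]]|].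
  exists (a + b)%MM; first by exists a => //; exists b.
  by exists c => //; rewrite addmA.
move=> _ [_ [a Aa [b Bb <-]] [c Cc <-]]; exists a => //; exists (b + c)%MM.
  by exists b => //; exists c.
by rewrite addmA.
Qed.

Lemma msumC : commutative (@msum n).
Proof.
by move=> A B; apply/seteqP; split=> _ [a Aa [b Bb <-]]; exists b => //; exists a => //;
   rewrite addmC.
Qed.

Lemma msum0 : left_id [set 0%MM] (@msum n).
Proof.
move=> A; apply/seteqP; split=> [_ [_ -> [a Aa <-]]|a Aa]; first by rewrite add0m.
by exists 0%MM => //; exists a => //; rewrite add0m.
Qed.

HB.instance Definition _ :=
  Monoid.isComLaw.Build (set 'X_{1..n}) [set 0%MM] (@msum n) msumA msumC msum0.

End MinkowskiMonoid.

Section Transversal.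
Context {n : nat}.
Implicit Types (A B : set 'X_{1..n}) (m u v w : 'X_{1..n}) (i j l : 'I_n).
Implicit Types (F G : {set 'I_n}) (s t T : seq {set 'I_n}).

(** The exponents of the generators of the product of the ideals [var_ideal F]. *)
Definition transversal_base s : set 'X_{1..n} := \big[@msum n / [set 0%MM]]_(F <- s) simplex F.

Lemma transversal_base_cons F s : transversal_base (F :: s) = msum (simplex F) (transversal_base s).
Proof. exact: big_cons. Qed.

Lemma transversal_base_cat s t : transversal_base (s ++ t) = msum (transversal_base s) (transversal_base t).
Proof. exact: big_cat. Qed.

Lemma perm_transversal_base s t : perm_eq s t -> transversal_base s = transversal_base t.
Proof. exact: perm_big. Qed.

Lemma mpow_transversal_base s k : mpow (transversal_base s) k = transversal_base (flatten (nseq k s)).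
Proof.
elim: k => [|k IH] /=; first by rewrite /transversal_base big_nil.
by rewrite transversal_base_cat -IH.
Qed.

Lemma transversal_base_equidegree s : equidegree (size s) (transversal_base s).
Proof.
elim: s => [|F s IH] a; first by rewrite /transversal_base big_nil => ->; rewrite mdeg0.
by rewrite transversal_base_cons; apply: (msum_mdeg (@simplex_mdeg n F) IH).
Qed.

Lemma transversal_base_exchange s : exchange (transversal_base s).
Proof.
elim: s => [|F s IH]; first by rewrite /transversal_base big_nil; apply: exchange0.
by rewrite transversal_base_cons msumC; apply: exchange_msum_simplex.
Qed.

Lemma transversal_base_fdeg F s a : transversal_base s a -> (count (fun G => G \subset F) s <= fdeg F a)%N.
Proof.
elim: s a => [//|G s IH] a; rewrite transversal_base_cons.
move=> [_ [i iG <-] [b /IH bF <-]]; rewrite fdegD fdeg1 /=; apply: leq_add => //.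
by case: (boolP (G \subset F)) => // /fintype.subsetP ->.
Qed.

Lemma covered_transversal_base_cons F s u i :
  i \in F -> covered (transversal_base s) u -> covered (transversal_base (F :: s)) (u + U_(i))%MM.
Proof.
move=> iF su; rewrite transversal_base_cons addmC; apply: covered_msum su.
exact/covered_id/mem_simplex.
Qed.

Definition matching (r : seq ({set 'I_n} * 'I_n)) :=
  all (fun p : {set 'I_n} * 'I_n => p.2 \in p.1) r.

Lemma fdeg_mdeg F u : (fdeg F u <= mdeg u)%N.
Proof.
rewrite mdeg_fdegT [in X in (_ <= X)%N]/fdeg (bigID (mem F)) /=.
by rewrite (eq_bigl (mem F)) ?leq_addr // => x; rewrite inE.
Qed.

Lemma matching_of_transversal_base s a : transversal_base s a -> exists r : seq ({set 'I_n} * 'I_n),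
  [/\ unzip1 r = s, matching r & a = mnm_of_word (unzip2 r)].
Proof.
elim: s a => [|F s IH] a.
  by rewrite /transversal_base big_nil => ->; exists [::]; rewrite /mnm_of_word big_nil.
rewrite transversal_base_cons => -[_ [i iF <-] [b /IH [r [<- rP ->]] <-]].
exists ((F, i) :: r); split=> //=; first by rewrite iF.
by rewrite /mnm_of_word big_cons.
Qed.

Lemma transversal_base_of_matching (r : seq ({set 'I_n} * 'I_n)) :
  matching r -> transversal_base (unzip1 r) (mnm_of_word (unzip2 r)).
Proof.
elim: r => [|[F i] r IH] /=; first by rewrite /transversal_base /mnm_of_word !big_nil.
move=> /andP[iF /IH rt]; rewrite transversal_base_cons /mnm_of_word big_cons.
by exists U_(i)%MM; [apply: mem_simplex | exists (mnm_of_word (unzip2 r))].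
Qed.

(** The unions of connected subfamilies of [t], for the relation of meeting. *)
Inductive linked t : {set 'I_n} -> Prop :=
| linked_member F : F \in t -> linked t F
| linked_union F G i : linked t F -> G \in t -> i \in F -> i \in G -> linked t (F :|: G).

Lemma linked_sub s t F : {subset s <= t} -> linked s F -> linked t F.
Proof.
move=> st; elim=> [G /st|G H i _ GH /st Ht iG iH]; first exact: linked_member.
exact: (linked_union (i := i)).
Qed.

(** [v] lacks a single letter to cover [transversal_base T], and any letter of [F] will
    do: a spanning tree of [T] whose edges are labelled by common elements. *)
Definition tied T F v := [/\ forall l, l \in F -> covered (transversal_base T) (v + U_(l))%MM,
  all (fun G => G \subset F) T & (mdeg v < size T)%N].

Lemma tied1 G : tied [:: G] G 0%MM.
Proof.
split=> [l lG||]; rewrite /= ?mdeg0 ?fintype.subxx //.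
by apply: covered_transversal_base_cons => //; rewrite /transversal_base big_nil; apply: covered_id.
Qed.

Lemma tiedU T F v G i :
  tied T F v -> i \in F -> i \in G -> tied (G :: T) (F :|: G) (v + U_(i))%MM.
Proof.
move=> [vF TF vT] iF iG; split.
- move=> l; rewrite inE => /orP[lF|lG].
    have -> : (v + U_(i) + U_(l) = v + U_(l) + U_(i))%MM by rewrite -!addmA [(U_(i) + _)%MM]addmC.
    by apply: covered_transversal_base_cons => //; apply: vF.
  by apply: covered_transversal_base_cons => //; apply: vF.
- rewrite /= finset.subsetUr /=; apply: sub_all TF => H /fintype.subset_trans; apply.
  exact: finset.subsetUl.
- by rewrite mdegD mdeg1 addn1.
Qed.

(** An augmenting path argument. The monomial [u] consists of the letters of [v]
    for the tree [T], of those matched to the sets of [r] outside of the tree, and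
    of the unmatched letters [e]. If a set of [r] is matched to a letter of [F],
    it joins the tree. Otherwise an unmatched letter of [F] completes a covering,
    or [F] is a violator of Hall's condition. *)
Lemma augment t T F v (r : seq ({set 'I_n} * 'I_n)) e :
  tied T F v -> linked t F -> matching r ->
  {subset unzip1 r <= t} ->
  let u := (v + (mnm_of_word (unzip2 r) + e))%MM in
  covered (transversal_base (T ++ unzip1 r)) u \/ exists2 F', linked t F' &
    (fdeg F' u < count (fun G => G \subset F') (T ++ unzip1 r))%N.
Proof.
have [k] := ubnP (size r); elim: k => // k IH in T F v r *.
move=> rk vF tF rP rt u.
have [/hasP [[G i] pr /= iF]|/hasPn rF] := boolP (has (fun p => p.2 \in F) r).
  have iG : i \in G by have := allP rP _ pr.
  have Gt : G \in t by apply: rt; apply: (map_f fst pr).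
  have rr := perm_to_rem pr; set r' := rem _ r in rr.
  have e1 : perm_eq (T ++ unzip1 r) ((G :: T) ++ unzip1 r').
    rewrite perm_sym /= -cat1s perm_catCA perm_cat2l perm_sym.
    exact: (perm_map fst rr).
  have e2 : u = (v + U_(i) + (mnm_of_word (unzip2 r') + e))%MM.
    rewrite /u /mnm_of_word (perm_big _ (perm_map snd rr)) /= big_cons.
    by rewrite !addmA.
  rewrite (perm_transversal_base e1) e2.
  have sr' : (size r' < k)%N by rewrite size_rem //; case: (r) pr rk.
  have r'P : matching r' by apply/allP => p /mem_rem; apply: (allP rP).
  have r't : {subset unzip1 r' <= t}.
    by move=> H /mapP [p /mem_rem pr' ->]; apply: rt; apply: map_f.
  have [cov|[F' lF' cF']] :=
    IH _ _ _ _ sr' (tiedU vF iF iG) (linked_union tF Gt iF iG) r'P r't; first by left.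
  by right; exists F' => //; rewrite (permP e1).
have word0 : fdeg F (mnm_of_word (unzip2 r)) = 0%N.
  elim: (r) rF => [|p q IHq] rF; rewrite /mnm_of_word ?big_nil ?big_cons ?fdeg0 //.
  rewrite fdegD fdeg1 (negbTE (rF p _)) ?mem_head //; apply: IHq => x xq.
  by apply: rF; rewrite inE xq orbT.
have [vT TF vs] := vF.
have [/fdeg_gt0 [l lF el]|] := ltnP 0 (fdeg F e).
  left; apply: (@covered_le _ _ (v + U_(l) + mnm_of_word (unzip2 r))%MM).
    rewrite /u -addmA; apply: lem_add2; first exact: lepm_refl.
    by rewrite addmC; apply: lem_add2; [exact: lepm_refl | rewrite lep1mP -lt0n].
  by rewrite transversal_base_cat; apply: covered_msum; [apply: vT | apply/covered_id/transversal_base_of_matching].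
rewrite leqn0 => /eqP e0; right; exists F => //.
rewrite count_cat; move: TF; rewrite all_count => /eqP->.
rewrite /u !fdegD e0 word0 !addn0; apply: leq_trans (leq_addr _ _).
exact: leq_ltn_trans (fdeg_mdeg F v) vs.
Qed.

(** Hall's theorem, with the condition checked on unions of connected
    subfamilies only: those are the sets reached by alternating paths. *)
Lemma transversal_base_hall t u : covered (transversal_base t) u \/ exists2 F, linked t F &
  (fdeg F u < count (fun G => G \subset F) t)%N.
Proof.
elim: t => [|G t [cov|[F lF cF]]].
- by left; rewrite /transversal_base big_nil; exists 0%MM => //; apply/mnm_lepP => i; rewrite mnm0E.
- case: cov => _ /matching_of_transversal_base [r [rt rP ->]] /submK ru.
  have := @augment (G :: t) [:: G] G 0%MM r (u - mnm_of_word (unzip2 r))%MM (tied1 G).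
  rewrite add0m addmC ru /= rt; apply=> //; first by apply: linked_member; rewrite mem_head.
  by move=> x xt; rewrite inE xt orbT.
- right; exists F; first by apply: linked_sub lF => x xt; rewrite inE xt orbT.
  by apply: leq_trans cF _ => /=; rewrite leq_addl.
Qed.

Lemma linked_tied s F : linked s F ->
  exists T R v, perm_eq s (T ++ R) /\ tied T F v.
Proof.
elim=> [G Gs|{}F G i _ [T [R [v [sTR vF]]]] Gs iF iG].
  by exists [:: G], (rem G s), 0%MM; split; [exact: perm_to_rem | exact: tied1].
have := Gs; rewrite (perm_mem sTR) mem_cat => /orP[GT|GR].
  exists T, R, v; split=> //; have [_ /allP/(_ _ GT) GF _] := vF.
  by move/finset.setUidPl: GF => ->.
exists (G :: T), (rem G R), (v + U_(i))%MM; split; last exact: tiedU.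
apply: perm_trans sTR _; rewrite perm_sym /= -cat1s perm_catCA perm_cat2l perm_sym.
exact: perm_to_rem.
Qed.

(** A set inside of [F] contributes one of its letters to [w] and thus one to the
    degree in [F]; any other set contributes a letter outside of [F]. *)
Lemma tied_extend T R F v :
  (forall G, G \in R -> exists i, i \in G) ->
  (forall l, l \in F -> covered (transversal_base T) (v + U_(l))%MM) ->
  (fdeg F v < count (fun G => G \subset F) T)%N ->
  exists2 w, (forall l, l \in F -> covered (transversal_base (R ++ T)) (w + U_(l))%MM) &
    (fdeg F w < count (fun G => G \subset F) (R ++ T))%N.
Proof.
elim: R => [|G R IH] RN vF vT; first by exists v.
have [|w wF wR] := IH _ vF vT.
  by move=> H HR; apply: RN; rewrite inE HR orbT.
have [i iG iF] : exists2 i, i \in G & (i \in F) = (G \subset F) :> bool.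
  have [GF|/subsetPn [i iG /negbTE iF]] := boolP (G \subset F); last by exists i.
  have [i iG] := RN G (mem_head _ _); exists i => //.
  exact: (fintype.subsetP GF).
exists (w + U_(i))%MM => [l lF|] /=; last first.
  by rewrite fdegD fdeg1 iF [X in (X < _)%N]addnC ltn_add2l.
have -> : (w + U_(i) + U_(l) = w + U_(l) + U_(i))%MM by rewrite -!addmA [(U_(i) + _)%MM]addmC.
by apply: covered_transversal_base_cons => //; apply: wF.
Qed.

Lemma linked_saturated s F : (forall G, G \in s -> exists i, i \in G) -> linked s F ->
  exists2 w, (forall l, l \in F -> covered (transversal_base s) (w + U_(l))%MM) &
    (fdeg F w < count (fun G => G \subset F) s)%N.
Proof.
move=> sN /linked_tied [T [R [v [sTR [vF TF vT]]]]].
have sRT : perm_eq s (R ++ T) by apply: perm_trans sTR _; rewrite perm_catC.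
rewrite (perm_transversal_base sRT) (permP sRT); apply: tied_extend vF _.
  by move=> G GR; apply: sN; rewrite (perm_mem sTR) mem_cat GR orbT.
move: TF; rewrite all_count => /eqP->; exact: leq_ltn_trans (fdeg_mdeg F v) vT.
Qed.

Lemma symbolic_power_transversal (K : fieldType) s k :
  (forall G, G \in s -> exists i, i \in G) ->
  symbolic_power (mideal (transversal_base s) : set {mpoly K[n]}) k =
  ideal_pow (mideal (transversal_base s)) k.
Proof.
move=> sN; apply: symbolic_power_mideal => u; rewrite mpow_transversal_base.
have [//|[F lF uF] _] := transversal_base_hall (flatten (nseq k s)) u.
have {}lF : linked s F.
  apply: linked_sub lF => G /flattenP [t]; rewrite mem_nseq.
  by move=> /andP[_ /eqP->].
have [w wF ws] := linked_saturated sN lF.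
exists F, w, (count (fun G => G \subset F) s); split=> //.
  exact: transversal_base_fdeg.
by move: uF; rewrite count_flatten map_nseq sumn_nseq mulnC.
Qed.

Lemma transversal_mideal (K : fieldType) s :
  \big[@ideal_mul _ / setT]_(F <- s) var_ideal F =
  mideal (transversal_base s) :> set {mpoly K[n]}.
Proof.
elim: s => [|F s IH]; first by rewrite big_nil /transversal_base big_nil mideal1.
by rewrite big_cons IH var_idealE mideal_mul transversal_base_cons.
Qed.

(** The words below [s] are those with one letter in each initial segment. *)
Lemma borel_words (s : seq 'I_n) :
  [set mnm_of_word v | v in [set v | all2 (fun j i : 'I_n => (j <= i)%N) v s]] =
  transversal_base [seq [set j : 'I_n | (j <= i)%N]%SET | i : 'I_n <- s].
Proof.
elim: s => [|i s IH]; apply/seteqP; split=> a.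
- by move=> [[|//] _ <-]; rewrite /transversal_base /mnm_of_word !big_nil.
- by rewrite /transversal_base big_nil => ->; exists [::] => //; rewrite /mnm_of_word big_nil.
- move=> [[//|j v] /= /andP[ji vs] <-]; rewrite transversal_base_cons /mnm_of_word big_cons.
  exists U_(j)%MM; first by apply: mem_simplex; rewrite inE.
  by rewrite -IH; exists (mnm_of_word v) => //; exists v.
- rewrite /= transversal_base_cons -IH => -[_ [j + <-] [_ [v vs <-] <-]].
  rewrite /= inE => ji; exists (j :: v); first by rewrite /= ji.
  by rewrite /mnm_of_word big_cons.
Qed.

End Transversal.

(** * Polymatroidal ideals of degree 2 containing a square *)

Section DegreeTwo.
Context {n : nat}.
Implicit Types (m u v w : 'X_{1..n}) (i j l a b c : 'I_n) (F G : {set 'I_n}).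

Lemma fdeg_subset F G u : F \subset G -> (fdeg F u <= fdeg G u)%N.
Proof.
move=> FG; rewrite /fdeg [in X in (_ <= X)%N](big_setID F) /=.
by move/finset.setIidPr: FG => ->; apply: leq_addr.
Qed.

Lemma fdegID F G u : F \subset G -> fdeg G u = (fdeg F u + fdeg (G :\: F)%SET u)%N.
Proof.
by move=> /finset.setIidPr FG; rewrite /fdeg (big_setID F) FG.
Qed.

Lemma fdegU1 F i u : i \notin F -> fdeg (i |: F)%SET u = (u i + fdeg F u)%N.
Proof. by move=> iF; rewrite /fdeg big_setU1. Qed.

Lemma fdeg_exceeded F u v i : (fdeg F u <= fdeg F v)%N -> i \in F -> (v i < u i)%N ->
  exists2 j, j \in F & (u j < v j)%N.
Proof.
move=> uv iF vui; apply/exists_inP; apply: contraLR uv.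
move=> /exists_inPn /= H; rewrite -ltnNge /fdeg (bigD1 i) //= [in X in (_ < X)%N](bigD1 i) //=.
rewrite -addSn; apply: leq_add => //; apply: leq_sum => j /andP[jF _].
by rewrite leqNgt; apply: H.
Qed.

Lemma mdeg_exceeded u v i : (mdeg u <= mdeg v)%N -> (v i < u i)%N ->
  exists j, (u j < v j)%N.
Proof.
rewrite !mdeg_fdegT => uv vui.
by have [|j _ uj] := fdeg_exceeded uv _ vui; [rewrite finset.in_setT | exists j].
Qed.

Lemma mdeg_gt0 u : (0 < mdeg u)%N -> exists i, (0 < u i)%N.
Proof. by rewrite mdeg_fdegT => /fdeg_gt0 [i _]; exists i. Qed.

Lemma fdeg_split F u a b : (U_(a) + U_(b) <= u)%MM ->
  fdeg F u = (fdeg F (u - (U_(a) + U_(b)))%MM + ((a \in F) + (b \in F)))%N.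
Proof. by move=> /submK abu; rewrite -{1}abu !fdegD !fdeg1. Qed.

Context (B : set 'X_{1..n}) (d : 'I_n).
Context (B2 : equidegree 2 B) (Bx : exchange B) (Bd : B (U_(d) + U_(d))%MM).

(** The generators are the edges of a graph, in which squares are loops. *)
Definition adj a b := `[< B (U_(a) + U_(b))%MM >].
Definition nbr c := [set l | adj c l]%SET.
Definition vertices := [set c | [exists l, adj c l]]%SET.

Lemma mem_nbr c l : (l \in nbr c) = adj c l.
Proof. exact: finset.in_set. Qed.

Lemma mem_vertices c : (c \in vertices) = [exists l, adj c l].
Proof. exact: finset.in_set. Qed.

Lemma adjC a b : adj a b = adj b a.
Proof. by rewrite /adj addmC. Qed.

Lemma mdeg2_pair m : B m -> exists a b, m = (U_(a) + U_(b))%MM /\ adj a b.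
Proof.
move=> Bm; have m2 := B2 Bm.
have [|a ma] := @mdeg_gt0 m; first by rewrite m2.
have am : (U_(a) <= m)%MM by rewrite lep1mP -lt0n.
have := mdegD (m - U_(a)) U_(a); rewrite submK // m2 mdeg1 => e.
have /eqP : mdeg (m - U_(a))%MM = 1%N by lia.
rewrite mdeg_eq1 => /existsP [b /eqP mb]; exists a, b.
have -> : m = (U_(a) + U_(b))%MM by rewrite -mb addmC submK.
split=> //; apply/asboolP; by rewrite -mb addmC submK.
Qed.

Lemma adj_vertices a b : adj a b -> (a \in vertices) && (b \in vertices).
Proof.
move=> ab; rewrite !mem_vertices; apply/andP; split; apply/existsP; first by exists b.
by exists a; rewrite adjC.
Qed.

Lemma nbr_vertices c : nbr c \subset vertices.
Proof. by apply/fintype.subsetP => l; rewrite mem_nbr => /adj_vertices /andP[]. Qed.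

Lemma adj_exchange a l b c : adj a l -> adj b c -> a != b -> a != c -> adj l b || adj l c.
Proof.
move=> /asboolP al /asboolP bc ab ac.
have [|j uj Bj] := Bx al bc (i := a).
  by rewrite !mnmDE !mnm1E eqxx [b == a]eq_sym [c == a]eq_sym (negbTE ab) (negbTE ac); lia.
have {}Bj : adj l j.
  by apply/asboolP; rewrite addmC [(U_(a) + _)%MM]addmC addmK addmC in Bj *.
move: uj; rewrite !mnmDE !mnm1E.
by case: (eqVneq b j) => [->|_]; case: (eqVneq c j) => [->|_]; rewrite ?Bj ?orbT //; lia.
Qed.

Lemma adj_loop a c : adj a a -> c \in vertices -> adj a c.
Proof.
move=> aa; rewrite mem_vertices => /existsP [l cl].
have [<-|la] := eqVneq l a; first by rewrite adjC.
by rewrite adjC; have := adj_exchange; move/(_ l c a a); rewrite orbb; apply=> //; rewrite adjC.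
Qed.

Lemma loop_d : adj d d.
Proof. exact/asboolP. Qed.

(** Not being adjacent is transitive on the vertices without a loop: the loop
    [d] is adjacent to [c], and exchanging [d] in the edge [{d, c}] towards the
    edge [{a, l}] can only produce the edge [{c, l}]. *)
Lemma nbr_sub a c : a \in vertices -> c \in vertices -> ~~ adj c a ->
  nbr a \subset nbr c.
Proof.
move=> aV cV nca; apply/fintype.subsetP => l; rewrite !mem_nbr => al.
have [->|ld] := eqVneq l d; first by rewrite adjC; apply: adj_loop loop_d _.
have da : d != a.
  by apply: contraNneq nca => <-; rewrite adjC; apply: adj_loop loop_d _.
have := @adj_exchange d c a l (adj_loop loop_d cV) al da; rewrite eq_sym.
by move/(_ ld); rewrite (negbTE nca).
Qed.

Lemma nbr_eq a c : a \in vertices -> c \in vertices -> ~~ adj c a -> nbr a = nbr c.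
Proof.
move=> aV cV nca; apply/eqP; rewrite finset.eqEsubset !nbr_sub //.
by rewrite adjC.
Qed.

Lemma nbr_loop c : adj c c -> nbr c = vertices.
Proof.
move=> cc; apply/eqP; rewrite finset.eqEsubset nbr_vertices; apply/fintype.subsetP => l lV.
by rewrite mem_nbr; apply: adj_loop.
Qed.

(** The inequalities that describe the [k]-th power: it is the intersection of
    the [k * 2]-th power of [var_ideal vertices] and of the [k]-th powers of the
    ideals [var_ideal (nbr c)]. *)
Definition wide k u := (k * 2 <= fdeg vertices u)%N /\
  forall c, c \in vertices -> (k <= fdeg (nbr c) u)%N.

Lemma wide_mem u : B u -> wide 1 u.
Proof.
move=> /mdeg2_pair [a [b [-> ab]]]; split.
  by rewrite fdegD !fdeg1; have /andP[-> ->] := adj_vertices ab.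
move=> c cV; rewrite fdegD !fdeg1 !mem_nbr.
case: (boolP (adj c a)) => // nca.
have /andP[aV _] := adj_vertices ab.
have : b \in nbr a by rewrite mem_nbr.
by rewrite (nbr_eq aV cV nca) mem_nbr => ->.
Qed.

Lemma wide_mpow k u : mpow B k u -> wide k u.
Proof.
elim: k u => [|k IH] u /=; first by move=> _; split.
move=> [a /wide_mem [aV aN] [b /IH [bV bN] <-]]; split.
  by rewrite fdegD mulSn leq_add.
by move=> c cV; rewrite fdegD -add1n leq_add ?aN ?bN.
Qed.

Lemma fdeg_outside k u c : (k * 2 <= fdeg vertices u)%N -> fdeg (nbr c) u = k ->
  (k <= fdeg (vertices :\: nbr c)%SET u)%N.
Proof.
move=> uV cu; rewrite -(leq_add2l (fdeg (nbr c) u)) -(fdegID u (nbr_vertices c)) cu.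
by lia.
Qed.

(** Splitting off one edge decreases the degree in each neighbourhood by at most
    2. If some [nbr c] has exactly the degree [k.+1], the edge is chosen from a
    letter outside of [nbr c] to one inside; a neighbourhood that contains both
    ends then contains all vertices outside of [nbr c], so that its degree is at
    least [k.+2]. *)
Lemma wide_step k u : wide k.+1 u -> exists a b,
  [/\ adj a b, (U_(a) + U_(b) <= u)%MM & wide k (u - (U_(a) + U_(b)))%MM].
Proof.
move=> [uV uN].
have pair a b : adj a b -> (U_(a) + U_(b) <= u)%MM ->
    (forall c, c \in vertices -> a \in nbr c -> b \in nbr c ->
       (k.+2 <= fdeg (nbr c) u)%N) ->
    exists a b, [/\ adj a b, (U_(a) + U_(b) <= u)%MM & wide k (u - (U_(a) + U_(b)))%MM].
  move=> ab abu H; exists a, b; split=> //; split.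
    have := fdeg_split vertices abu; case: (_ \in _); case: (_ \in _); lia.
  move=> c cV; have := fdeg_split (nbr c) abu.
  move: (uN c cV) (H c cV); case: (a \in _); case: (b \in _) => h1 h2 h3; lia.
have [/exists_inP [c cV /eqP cu]|/exists_inPn nt] :=
    boolP [exists (c | c \in vertices), fdeg (nbr c) u == k.+1]; last first.
  have [|a aV ua] := @fdeg_gt0 _ vertices u; first by lia.
  have loose c : c \in vertices -> (k.+2 <= fdeg (nbr c) u)%N.
    by move=> cV; have := uN c cV; rewrite leq_eqVlt eq_sym (negbTE (nt c cV)).
  have au : (U_(a) <= u)%MM by rewrite lep1mP -lt0n.
  have [|b ab ub] := @fdeg_gt0 _ (nbr a) (u - U_(a))%MM.
    have := loose a aV; rewrite -{1}(submK au) fdegD fdeg1.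
    by case: (_ \in _); lia.
  apply: (pair a b) => [||c cV _ _]; first by rewrite mem_nbr in ab.
    rewrite -(submK au) addmC; apply: lem_add2; last exact: lepm_refl.
    by rewrite lep1mP -lt0n.
  exact: loose.
have outside : (k.+1 <= fdeg (vertices :\: nbr c)%SET u)%N.
  exact: fdeg_outside.
have [|a aVc ua] := @fdeg_gt0 _ (vertices :\: nbr c)%SET u; first by lia.
have [|b bc ub] := @fdeg_gt0 _ (nbr c) u; first by lia.
have /andP[nca aV] : (a \notin nbr c) && (a \in vertices) by move: aVc; rewrite finset.in_setD.
have Nac : nbr a = nbr c by apply: nbr_eq => //; move: nca; rewrite mem_nbr.
apply: (pair a b) => [||c' c'V ac' bc'].
- by move: bc; rewrite -Nac mem_nbr.
- apply/mnm_lepP => x; rewrite mnmDE !mnm1E.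
  have ab : a != b by apply: contraNneq nca => ->.
  have [<-|_] := eqVneq a x; first by rewrite [b == a]eq_sym (negbTE ab); lia.
  by have [<-|_] := eqVneq b x; lia.
have sub : b |: (vertices :\: nbr c) \subset nbr c'.
  apply/fintype.subsetP => x; rewrite in_setU1 => /orP[/eqP->//|].
  rewrite finset.in_setD => /andP[ncx xV].
  have Nx : nbr x = nbr c by apply: nbr_eq => //; move: ncx; rewrite mem_nbr.
  by rewrite mem_nbr adjC; have : c' \in nbr x; [rewrite Nx -Nac mem_nbr adjC; rewrite mem_nbr in ac' | rewrite mem_nbr].
apply: leq_trans (fdeg_subset u sub); rewrite fdegU1; first by lia.
by rewrite finset.in_setD bc.
Qed.

Lemma covered_mpow2 k u : wide k u -> covered (mpow B k) u.
Proof.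
elim: k u => [|k IH] u.
  by move=> _; exists 0%MM => //; apply/mnm_lepP => i; rewrite mnm0E.
move=> /wide_step [a [b [ab abu /IH cov]]]; rewrite -(submK abu) addmC.
by apply: covered_msum cov => //; apply/covered_id/asboolP.
Qed.

Lemma symbolic_power_degree2 (K : fieldType) k :
  symbolic_power (mideal B : set {mpoly K[n]}) k = ideal_pow (mideal B) k.
Proof.
apply: symbolic_power_mideal => u nu.
have [Vu|Vu] := ltnP (fdeg vertices u) (k * 2).
  exists vertices, U_(d)%MM, 2; split=> //.
  - by move=> i iV; apply/covered_id/asboolP/adj_loop => //; apply: loop_d.
  - by rewrite fdeg1; case: (_ \in _).
  - by move=> a /wide_mem [].
have [/exists_inP [c cV cu]|/exists_inPn H] :=
    boolP [exists (c | c \in vertices), (fdeg (nbr c) u < k)%N]; last first.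
  case: nu; apply: covered_mpow2; split=> // c cV.
  by rewrite leqNgt; apply: H.
exists (nbr c), U_(c)%MM, 1%N; split; last by rewrite muln1.
- by move=> i; rewrite mem_nbr => /asboolP; apply: covered_id.
- rewrite fdeg1; case: (boolP (c \in _)) => //; rewrite mem_nbr => /nbr_loop e.
  by move: cu; rewrite e; lia.
- by move=> a /wide_mem [_]; apply.
Qed.

Lemma mpow2E k u : mpow B k u <-> mdeg u = (k * 2)%N /\ wide k u.
Proof.
split=> [Bu|[ku /covered_mpow2]]; last exact: covered_eq (mpow_mdeg B2) ku.
by split; [exact: (mpow_mdeg B2) Bu | exact: wide_mpow].
Qed.

(** If [i] cannot be traded for [j], then the neighbourhood of [j] contains [i]
    and has the minimal degree [k] in [u]. If every trade fails, this holds for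
    two adjacent [j], and the complements of their neighbourhoods are disjoint and
    account for all [k * 2] letters of [u], leaving no room for the letter [i]. *)
Lemma exchange_mpow2 k : exchange (mpow B k).
Proof.
move=> u v /mpow2E [ku [uV uN]] /mpow2E [kv [vV vN]] i vui.
have inV w x : mdeg w = (k * 2)%N -> (k * 2 <= fdeg vertices w)%N -> (0 < w x)%N ->
    x \in vertices.
  move=> kw wV wx; apply: contraLR wV => xV; rewrite -ltnNge -kw.
  apply: leq_trans (fdeg_mdeg (x |: vertices)%SET w); rewrite fdegU1 //; lia.
have iV : i \in vertices by apply: inV ku uV _; lia.
have iu : (U_(i) <= u)%MM by rewrite lep1mP; lia.
have trade F j : (fdeg F (u - U_(i) + U_(j))%MM + (i \in F) = fdeg F u + (j \in F))%N.
  by rewrite -[in RHS](submK iu) !fdegD !fdeg1; lia.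
have [/exists_inP [j juv Bj]|/exists_inPn bad] :=
    boolP [exists (j | (u j < v j)%N), `[< mpow B k (u - U_(i) + U_(j))%MM >]].
  by exists j => //; apply/asboolP.
have tight j : (u j < v j)%N ->
    [/\ j \in vertices, i \in nbr j, j \notin nbr j & fdeg (nbr j) u = k].
  move=> juv; have jV : j \in vertices by apply: inV kv vV _; lia.
  have /asboolP nBj := bad j juv.
  have [/exists_inP [c cV cu]|/exists_inPn H] :=
    boolP [exists (c | c \in vertices), (fdeg (nbr c) (u - U_(i) + U_(j))%MM < k)%N].
    have := trade (nbr c) j; have := uN c cV.
    case: (boolP (i \in nbr c)) => ic; case: (boolP (j \in nbr c)) => jc h1 h2; try lia.
    have Njc : nbr j = nbr c by apply: nbr_eq => //; move: jc; rewrite mem_nbr.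
    by split; rewrite ?Njc //; lia.
  case: nBj; apply/mpow2E; split; first by rewrite mdeg_trade //; lia.
  split=> [|c cV]; last by rewrite leqNgt; apply: H.
  by have := trade vertices j; rewrite iV jV; lia.
have [|j0 uj0] := @mdeg_exceeded u v i _ vui; first by rewrite ku kv.
have [j0V ij0 j00 e0] := tight _ uj0.
have [|j1 j01 uj1] := @fdeg_exceeded (nbr j0) u v i _ ij0 vui; first by rewrite e0 vN.
have [j1V ij1 j11 e1] := tight _ uj1.
have sub : i |: (vertices :\: nbr j1) \subset nbr j0.
  apply/fintype.subsetP => x; rewrite in_setU1 => /orP[/eqP->//|].
  rewrite finset.in_setD => /andP[n1x xV]; apply: contraNT j11 => n0x.
  have Nx0 : nbr x = nbr j0 by apply: nbr_eq => //; move: n0x; rewrite mem_nbr.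
  have Nx1 : nbr x = nbr j1 by apply: nbr_eq => //; move: n1x; rewrite mem_nbr.
  by rewrite -Nx1 Nx0.
have := fdeg_subset u sub; rewrite fdegU1 ?finset.in_setD ?ij1 // e0.
by have := fdeg_outside uV e1; lia.
Qed.

End DegreeTwo.

(** * The three families *)

Lemma degree2_mideal n (K : fieldType) (I : set {mpoly K[n]}) :
  polymatroidal_deg2_not_squarefree I -> exists B d,
    [/\ I = mideal B, equidegree 2 B, exchange B & B (U_(d) + U_(d))%MM].
Proof.
move=> [[mI _ _ Ix] I2 [u Iu nsf]]; exists (mingens I).
have [d ud] : exists d, (1 < u d)%N.
  by move: nsf => /existsNP [d /negP]; rewrite -ltnNge; exists d.
exists d; split=> //; first exact: monomial_ideal_mingens.
suff -> : (U_(d) + U_(d))%MM = u by [].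
apply: lem_mdeg_eq; last by rewrite mdegD !mdeg1 (I2 _ Iu).
apply/mnm_lepP => i; rewrite mnmDE !mnm1E.
by have [<-|] := eqVneq d i; lia.
Qed.

Lemma principal_borel_transversal n (K : fieldType) (I : set {mpoly K[n]}) :
  principal_borel I -> transversal_polymatroidal I.
Proof.
move=> [w [_ mI Iw]]; exists [seq [set j : 'I_n | (j <= i)%N]%SET | i : 'I_n <- w].
  by move=> F /mapP [i _ ->]; exists i; rewrite finset.in_set.
by rewrite transversal_mideal -borel_words -Iw; apply: monomial_ideal_mingens.
Qed.

Theorem theorem5p8 (n : nat) (K : fieldType) (I : set {mpoly K[n]})
    (hI : polymatroidal_deg2_not_squarefree I \/
          transversal_polymatroidal I \/
          principal_borel I)
    (k : nat) (hk : (1 <= k)%N) :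
  [/\ symbolic_power I k = ideal_pow I k,
      reg (symbolic_power I k) = reg (ideal_pow I k),
      linear_quotients (symbolic_power I k)
    & componentwise_linear (symbolic_power I k)].
Proof.
suff [B [d [Ik IB Bd Bx]]] : exists B d,
    [/\ symbolic_power I k = ideal_pow I k, ideal_pow I k = mideal B,
        equidegree d B & exchange B].
  rewrite Ik IB; split=> //; first exact: linear_quotients_exchange Bd Bx.
  exact: componentwise_linear_exchange Bd Bx.
have transversal : transversal_polymatroidal I -> exists B d,
    [/\ symbolic_power I k = ideal_pow I k, ideal_pow I k = mideal B,
        equidegree d B & exchange B].
  move=> [s sN ->]; rewrite transversal_mideal.
  exists (mpow (transversal_base s) k), (k * size s)%N; split.
  - exact: symbolic_power_transversal.
  - exact: mideal_pow.
  - exact: mpow_mdeg (@transversal_base_equidegree n s).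
  - by rewrite mpow_transversal_base; apply: transversal_base_exchange.
case: hI => [/degree2_mideal [B [d [-> B2 Bx Bd]]]|[//|/principal_borel_transversal //]].
exists (mpow B k), (k * 2)%N; split.
- exact: symbolic_power_degree2 B2 Bx Bd _ _.
- exact: mideal_pow.
- exact: mpow_mdeg.
- exact: exchange_mpow2 B2 Bx Bd _.
Qed.
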